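(* Let $h\in\Omega_{\rho_\varepsilon}$ and $v\in H^1(0,1)$ with $\langle v,u^h_i\rangle=0$ for $i=1,\dots,N+1$, and assume $\|v\|<\varepsilon^{1/2+m}$ for some $m>0$. Then (for $\varepsilon$ sufficiently small) $$\langle\mathcal L^hv+\mathcal N^h(v),v\rangle\le-\tfrac12\lambda_0\|v\|^2 .$$
   Context: $0<\varepsilon\ll1$; $f(u)=u^3-u$; $\langle\cdot,\cdot\rangle$, $\|\cdot\|$ inner product and norm of $L^2(0,1)$. $U(x)=\tanh(x/\sqrt2)$; $U(x;\xi,\pm1)=\pm U((x-\xi)/\varepsilon)$. Fix an integer $N\ge0$, small $\kappa_0>0$, $\rho_\varepsilon=\varepsilon^{\kappa_0}$. $\Omega_{\rho_\varepsilon}=\{h\in\mathbb R^{N+1}:0<h_1<\dots<h_{N+1}<1,\ \min_{j=0,\dots,N+1}|h_{j+1}-h_j|>\varepsilon/\rho_\varepsilon\}$ with $h_0=-h_1$, $h_{N+2}=2-h_{N+1}$. For $h\in\Omega_{\rho_\varepsilon}$, $u^h=\sum_{j=1}^{N+1}U(\cdot;h_j,(-1)^{j+1})+\beta_N$, where $\beta_N=\frac{(-1)^N-1}{2}+\mathcal O(\exp)$ (also for derivatives; $\mathcal O(\exp)$ exponentially small in $\varepsilon$) makes $u^h(0)=-1$ and $u^h$ satisfy Neumann boundary conditions. $u^h_i=\partial_{h_i}u^h$. $\mathcal L^hv=\varepsilon^2v_{xx}-f'(u^h)v$ and $\mathcal N^h(v)=f(u^h)-f(u^h+v)+f'(u^h)v=-3u^hv^2-v^3$.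 $\lambda_0>0$ is a constant such that every $w\in H^1(\mathbb R)$ with $w(0)=0$ or $\int_{\mathbb R}wU'=0$ satisfies $\int_{\mathbb R}(-w'^2-f'(U)w^2)\le-\lambda_0\|w\|^2_{L^2(\mathbb R)}$. *)

(* Defs.v *)
From HB Require Import structures.
From mathcomp Require Import all_boot all_order all_algebra.
From mathcomp Require Import all_classical all_reals all_analysis.
Set Implicit Arguments. Unset Strict Implicit. Unset Printing Implicit Defensive.
Import Order.TTheory GRing.Theory Num.Theory.
Import numFieldNormedType.Exports.
Local Open Scope classical_set_scope.
Local Open Scope ring_scope.

Section Defs.
Variable R : realType.

Local Notation leb := (@lebesgue_measure R).
Definition itv01 : set R := `[0, 1].

Definition fAC (u : R) : R := u ^+ 3 - u.
Definition fAC' (u : R) : R := 3 * u ^+ 2 - 1.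

Definition tanhR (x : R) : R := (expR x - expR (- x)) / (expR x + expR (- x)).

Definition Uprof (x : R) : R := tanhR (x / Num.sqrt 2).

Definition Ushift (eps xi s x : R) : R := s * Uprof ((x - xi) / eps).

Definition L2ip (v w : R -> R) : R := \int[leb]_(x in itv01) (v x * w x).
Definition L2norm (v : R -> R) : R := Num.sqrt (L2ip v v).

(* H^1(0,1): v is (a representative of) an H^1 function with weak derivative
   dv in L^2(0,1) (absolutely continuous characterization). *)
Definition H1_01 (v dv : R -> R) : Prop :=
  measurable_fun itv01 dv /\
  (\int[leb]_(x in itv01) ((dv x ^+ 2)%:E) < +oo)%E /\
  forall a b, 0 <= a -> a <= b -> b <= 1 ->
    v b - v a = \int[leb]_(x in `[(a:R), b]) dv x.

Definition H1_R (w dw : R -> R) : Prop :=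
  measurable_fun setT dw /\
  (\int[leb]_(x in [set: R]) ((dw x ^+ 2)%:E) < +oo)%E /\
  (\int[leb]_(x in [set: R]) ((w x ^+ 2)%:E) < +oo)%E /\
  forall a b, a <= b -> w b - w a = \int[leb]_(x in `[(a:R), b]) dw x.

Definition spectral_gap (lam0 : R) : Prop :=
  forall w dw, H1_R w dw ->
    (w 0 = 0 \/ \int[leb]_(x in [set: R]) (w x * derive1 Uprof x) = 0) ->
    \int[leb]_(x in [set: R]) (- dw x ^+ 2 - fAC' (Uprof x) * w x ^+ 2)
      <= - lam0 * \int[leb]_(x in [set: R]) (w x ^+ 2).

(* positions h = (h_1, ..., h_{N+1}) are row vectors, h_j = h 0 (j-1) *)
Definition hcoord N (h : 'rV[R]_N.+1) (j : nat) : R := h 0 (inord j).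

(* extended sequence h_0 = -h_1, h_1..h_{N+1}, h_{N+2} = 2 - h_{N+1} *)
Definition hext N (h : 'rV[R]_N.+1) (k : nat) : R :=
  if k == 0%N then - hcoord h 0
  else if (k <= N.+1)%N then hcoord h k.-1
  else 2 - hcoord h N.

(* Omega_{rho_eps}, rho_eps = eps^kappa0 *)
Definition Omega N (kappa0 eps : R) (h : 'rV[R]_N.+1) : Prop :=
  0 < hcoord h 0 /\
  (forall j, (j < N)%N -> hcoord h j < hcoord h j.+1) /\
  hcoord h N < 1 /\
  forall k, (k <= N.+1)%N ->
    eps / (eps `^ kappa0) < `|hext h k.+1 - hext h k|.

Definition uh N (beta : R -> 'rV[R]_N.+1 -> R -> R) (eps : R)
  (h : 'rV[R]_N.+1) (x : R) : R :=
  \sum_(i < N.+1) Ushift eps (h 0 i) ((-1) ^+ i) x + beta eps h x.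

Definition uhi N beta eps (h : 'rV[R]_N.+1) (i : 'I_N.+1) (x : R) : R :=
  'D_(delta_mx 0 i) (fun h' => uh beta eps h' x) h.

Definition cN (N : nat) : R := ((-1) ^+ N - 1) / 2.

Definition beta_adm N (kappa0 : R) (beta : R -> 'rV[R]_N.+1 -> R -> R) : Prop :=
  exists C c k : R, 0 < C /\ 0 < c /\ 0 < k /\
  forall eps h, 0 < eps < 1 -> Omega kappa0 eps h ->
    [/\ forall x, derivable (beta eps h) x 1,
        forall x i, derivable (fun h' => beta eps h' x) h (delta_mx 0 i),
        forall x, 0 <= x <= 1 ->
          [/\ `|beta eps h x - cN N| <= C * expR (- c / eps `^ k),
              `|derive1 (beta eps h) x| <= C * expR (- c / eps `^ k) &
              forall i, `|'D_(delta_mx 0 i) (fun h' => beta eps h' x) h|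
                         <= C * expR (- c / eps `^ k)],
        uh beta eps h 0 = -1 &
        derive1 (uh beta eps h) 0 = 0 /\ derive1 (uh beta eps h) 1 = 0].

(* <L^h v + N^h(v), v>, with <L^h v, v> in weak form (Neumann) *)
Definition NLh N beta eps (h : 'rV[R]_N.+1) (v : R -> R) (x : R) : R :=
  fAC (uh beta eps h x) - fAC (uh beta eps h x + v x)
  + fAC' (uh beta eps h x) * v x.

Definition form_LN N beta eps (h : 'rV[R]_N.+1) (v dv : R -> R) : R :=
  - eps ^+ 2 * \int[leb]_(x in itv01) (dv x ^+ 2)
  - \int[leb]_(x in itv01) (fAC' (uh beta eps h x) * v x ^+ 2)
  + L2ip (NLh beta eps h v) v.

End Defs.

(* Main.v *)
(** The quadratic form splits over the interval into pieces, each containing one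
kink. Between neighbouring kinks, a layer of width comparable to
[eps^(1 - kappa0)] contains a cut point [m] with [eps * v m ^ 2] negligible
against [|v|^2]; cutting there costs almost nothing, so neither a partition of
unity nor a product rule is needed. On the piece around the [i]-th kink, [u^h]
is uniformly close to [+-U((x - h_i)/eps)], and in the stretched variable the
restriction of [v] becomes, after subtracting hat functions of small size, a
compactly supported [H^1] function orthogonal to [U']: the spectral gap of the
line applies. The overlap with [U'] is small because [u^h_i] is
[-+ U'((x - h_i)/eps)/eps] up to exponentially small terms. On the two end
pieces [f'(u^h)] is close to 2, and [lam0 <= 3], so [5/8 lam0 < 2] is available
everywhere. Finally a small multiple of [eps^2 |v'|^2], kept from the
linear part, controls the cubic term through
[v^2 <= 2 (|v|^2/eps + eps |v'|^2)]. *)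
Require Import Defs.
From HB Require Import structures.
From mathcomp Require Import all_boot all_order all_algebra.
From mathcomp Require Import all_classical all_reals all_analysis.
From mathcomp Require Import measurable_realfun ring lra.
Import Order.TTheory GRing.Theory Num.Theory.
Import numFieldNormedType.Exports.
Local Open Scope classical_set_scope.
Local Open Scope ring_scope.

(** * Integration on segments *)

Section IntervalIntegral.
Context {R : realType}.
Local Notation leb := (@lebesgue_measure R).
Implicit Types (a b c k : R) (f g : R -> R).

(** Two defects separate the restriction of [v] to a piece from an admissible test function of the
    gap: nonzero values at the cut points, and an overlap with [U'] that does not vanish because
    orthogonality is to [u^h_i] over all of [[0, 1]]. Both enter quadratically, with a constant
    fixed by [lam0] and a tolerance alone, before [eps], [h] and [v]. Hence the order of choices:
    the tolerance [s = lam0 / 200], then that constant, then [eps]. Uniformity in [h] follows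
    because [h] enters only through the separation of the kinks and the bounds on [beta]. Correcting
    the test function costs a fraction of [eps^2 |v'|^2], and so does the cubic term. This fraction
    is repaid by mixing the coercive estimate, with weight [1 - lam0 / 32], with the crude bound
    [f' >= -1], with weight [lam0 / 32]; the room between [5/8 lam0] and [lam0 / 2] pays for the
    mixture. The exponent [1/2 + m] is what makes [|v|^2 / eps], the dangerous part of the sup
    bound, tend to 0. *)

Definition itg a b f : R := \int[leb]_(x in `[a, b]) f x.
Definition itgable a b f := leb.-integrable `[a, b] (EFin \o f).
(** Two classes suffice: bounded measurable functions, stable under ring operations and integrable
    on segments, for [v], [u^h] and the profile; and [sq_itgable] for weak derivatives, which need
    not be bounded. *)
Definition bdd_meas a b f :=
  measurable_fun `[a, b] f /\ exists M, forall x, a <= x <= b -> `|f x| <= M.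
Definition sq_itgable a b f :=
  measurable_fun `[a, b] f /\ itgable a b (fun x => f x ^+ 2).

Lemma itgableD a b f g : itgable a b f -> itgable a b g ->
  itgable a b (fun x => f x + g x).
Proof. by move=> hf hg; exact: (integrableD _ hf hg). Qed.

Lemma itgableZ a b k f : itgable a b f -> itgable a b (fun x => k * f x).
Proof. by move=> hf; exact: (integrableZl _ k hf). Qed.

Lemma itgableN a b f : itgable a b f -> itgable a b (fun x => - f x).
Proof. by move=> hf; exact: (integrableN hf). Qed.

Lemma itgableB a b f g : itgable a b f -> itgable a b g ->
  itgable a b (fun x => f x - g x).
Proof. by move=> hf hg; apply: itgableD => //; exact: itgableN. Qed.

Lemma eq_itgable a b f g : (forall x, a <= x <= b -> f x = g x) ->
  itgable a b f -> itgable a b g.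
Proof.
move=> fg; apply: eq_integrable => // x; rewrite inE /= in_itv /= => xab.
by rewrite /= fg.
Qed.

Lemma itgableS a b c d f : a <= c -> d <= b -> itgable a b f -> itgable c d f.
Proof.
move=> ac db; apply: integrableS => //.
by apply: subset_itv; rewrite bnd_simp.
Qed.

Lemma itgable_meas a b f : itgable a b f -> measurable_fun `[a, b] f.
Proof. by move=> /measurable_int /measurable_EFinP. Qed.

Lemma bdd_meas_itgable a b f : bdd_meas a b f -> itgable a b f.
Proof.
move=> [mf [M bM]]; apply: measurable_bounded_integrable => //.
  rewrite /= lebesgue_measure_itv /=; case: ifPn => // _.
  by rewrite -EFinD ltry.
exists M; split; first exact: num_real.
move=> y My x /=; rewrite in_itv /= => xab.
exact: le_trans (bM _ xab) (ltW My).
Qed.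

Lemma bdd_measD a b f g : bdd_meas a b f -> bdd_meas a b g ->
  bdd_meas a b (fun x => f x + g x).
Proof.
move=> [mf [M bM]] [mg [K bK]]; split; first exact: measurable_funD.
exists (M + K) => x xab; apply: le_trans (ler_normD _ _) _.
by apply: lerD; [exact: bM|exact: bK].
Qed.

Lemma bdd_measM a b f g : bdd_meas a b f -> bdd_meas a b g ->
  bdd_meas a b (fun x => f x * g x).
Proof.
move=> [mf [M bM]] [mg [K bK]]; split; first exact: measurable_funM.
exists (M * K) => x xab; rewrite normrM.
by apply: ler_pM => //; [exact: bM|exact: bK].
Qed.

Lemma bdd_meas_cst a b k : bdd_meas a b (fun=> k).
Proof. by split; [exact: measurable_cst|exists `|k|]. Qed.

Lemma bdd_measN a b f : bdd_meas a b f -> bdd_meas a b (fun x => - f x).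
Proof.
move=> [mf [M bM]]; split; first exact: measurable_funN.
by exists M => x xab; rewrite normrN bM.
Qed.

Lemma bdd_measB a b f g : bdd_meas a b f -> bdd_meas a b g ->
  bdd_meas a b (fun x => f x - g x).
Proof. by move=> hf hg; apply: bdd_measD => //; exact: bdd_measN. Qed.

Lemma bdd_measX a b f n : bdd_meas a b f -> bdd_meas a b (fun x => f x ^+ n).
Proof.
move=> hf; elim: n => [|n ih].
  by under eq_fun do rewrite expr0; exact: bdd_meas_cst.
by under eq_fun do rewrite exprS; exact: bdd_measM.
Qed.

Lemma bdd_measS a b c d f : a <= c -> d <= b -> bdd_meas a b f -> bdd_meas c d f.
Proof.
move=> ac db [mf [M bM]]; split.
  by apply: measurable_funS mf => //; apply: subset_itv; rewrite bnd_simp.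
exists M => x /andP[cx xd]; apply: bM.
by rewrite (le_trans ac cx) (le_trans xd db).
Qed.

Lemma bdd_meas_within a b f : {within `[a, b], continuous f} -> bdd_meas a b f.
Proof.
move=> cf; split; first exact: subspace_continuous_measurable_fun.
have := @compact_bounded _ _ _ (continuous_compact cf (@segment_compact R a b)).
move=> [M [_ bM]]; exists (M + 1) => x xab; apply: (bM (M + 1)).
  by rewrite ltrDl.
by exists x => //=; rewrite in_itv.
Qed.

Lemma bdd_meas_cont a b f : continuous f -> bdd_meas a b f.
Proof. by move=> cf; apply: bdd_meas_within; exact: continuous_subspaceT. Qed.

Lemma bdd_meas_sq a b f : bdd_meas a b f -> sq_itgable a b f.
Proof.
by move=> hf; split; [case: hf|apply/bdd_meas_itgable/bdd_measX].
Qed.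

Lemma itgable_le a b f g : measurable_fun `[a, b] f -> itgable a b g ->
  (forall x, a <= x <= b -> `|f x| <= g x) -> itgable a b f.
Proof.
move=> mf ig fg; apply: (le_integrable _ _ _ ig) => //.
  exact/measurable_EFinP.
move=> x /=; rewrite in_itv /= => xab.
by rewrite lee_fin (le_trans (fg _ xab)) // ler_norm.
Qed.

Lemma sq_itgableM a b f g : sq_itgable a b f -> sq_itgable a b g ->
  itgable a b (fun x => f x * g x).
Proof.
move=> [mf f2] [mg g2]; apply: (@itgable_le _ _ _ (fun x => f x ^+ 2 + g x ^+ 2)).
- exact: measurable_funM.
- exact: itgableD.
move=> x _; rewrite ler_norml; apply/andP; split; nra.
Qed.

Lemma sq_itgable_itgable a b f : sq_itgable a b f -> itgable a b f.
Proof.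
move=> hf; have := sq_itgableM _ _ _ _ hf (bdd_meas_sq _ _ _ (bdd_meas_cst a b 1)).
by apply: eq_itgable => x _; rewrite mulr1.
Qed.

Lemma sq_itgableD a b f g : sq_itgable a b f -> sq_itgable a b g ->
  sq_itgable a b (fun x => f x + g x).
Proof.
move=> hf hg; split; first by apply: measurable_funD; [case: hf|case: hg].
have /(itgableZ _ _ 2) hfg := sq_itgableM _ _ _ _ hf hg.
case: hf hg => mf f2 [mg g2].
apply: eq_itgable (itgableD _ _ _ _ (itgableD _ _ _ _ f2 g2) hfg) => x _ /=.
by ring.
Qed.

Lemma sq_itgable_bddM a b f g : bdd_meas a b f -> sq_itgable a b g ->
  sq_itgable a b (fun x => f x * g x).
Proof.
move=> [mf [M bM]] [mg g2]; split; first exact: measurable_funM.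
apply: (@itgable_le _ _ _ (fun x => M ^+ 2 * g x ^+ 2)).
- by apply: measurable_funX; exact: measurable_funM.
- exact: itgableZ.
move=> x xab; rewrite ger0_norm ?sqr_ge0 // exprMn ler_wpM2r ?sqr_ge0 //.
rewrite -real_normK ?num_real // ler_sqr ?nnegrE //; first exact: bM.
exact: le_trans (bM _ xab).
Qed.

Lemma sq_itgableZ a b k f : sq_itgable a b f -> sq_itgable a b (fun x => k * f x).
Proof. by move=> hf; apply: sq_itgable_bddM => //; exact: bdd_meas_cst. Qed.

Lemma sq_itgableS a b c d f : a <= c -> d <= b ->
  sq_itgable a b f -> sq_itgable c d f.
Proof.
move=> ac db [mf f2]; split; last exact: itgableS f2.
by apply: measurable_funS mf => //; apply: subset_itv; rewrite bnd_simp.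
Qed.

Lemma itgD a b f g : itgable a b f -> itgable a b g ->
  itg a b (fun x => f x + g x) = itg a b f + itg a b g.
Proof. by move=> hf hg; rewrite /itg RintegralD. Qed.

Lemma itgZ a b k f : itgable a b f ->
  itg a b (fun x => k * f x) = k * itg a b f.
Proof. by move=> hf; rewrite /itg RintegralZl. Qed.

Lemma itgB a b f g : itgable a b f -> itgable a b g ->
  itg a b (fun x => f x - g x) = itg a b f - itg a b g.
Proof. by move=> hf hg; rewrite /itg RintegralB. Qed.

Lemma eq_itg a b f g : (forall x, a <= x <= b -> f x = g x) ->
  itg a b f = itg a b g.
Proof.
move=> fg; apply: eq_Rintegral => x; rewrite inE /= in_itv /=; exact: fg.
Qed.

Lemma itg_ge0 a b f : (forall x, a <= x <= b -> 0 <= f x) -> 0 <= itg a b f.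
Proof. by move=> f0; apply: Rintegral_ge0 => x /=; rewrite in_itv; exact: f0. Qed.

Lemma le_itg a b f g : itgable a b f -> itgable a b g ->
  (forall x, a <= x <= b -> f x <= g x) -> itg a b f <= itg a b g.
Proof.
by move=> hf hg fg; apply: le_Rintegral => // x /=; rewrite in_itv; exact: fg.
Qed.

Lemma itg_cst a b k : a <= b -> itg a b (fun=> k) = k * (b - a).
Proof.
move=> ab; rewrite /itg Rintegral_cst //= lebesgue_measure_itv /= lte_fin.
by move: ab; rewrite le_eqVlt => /predU1P[->|->//]; rewrite ltxx subrr.
Qed.

Lemma itg_split a b c f : a <= c <= b -> itgable a b f ->
  itg a b f = itg a c f + itg c b f.
Proof.
move=> /andP[ac cb] hf.
have := @Rintegral_itvB R f (BLeft a) (BRight b) c hf.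
rewrite !bnd_simp => /(_ ac cb); rewrite Rintegral_itv_obnd_cbnd.
  by move=> /eqP; rewrite subr_eq addrC => /eqP.
apply: integrableS hf => //=.
by apply: subset_itv; rewrite bnd_simp.
Qed.

Lemma itg_point a f : itg a a f = 0.
Proof. by rewrite /itg set_itv1 Rintegral_set1. Qed.

Lemma le_itg_sub a b c d f : a <= c -> c <= d -> d <= b -> itgable a b f ->
  (forall x, a <= x <= b -> 0 <= f x) -> itg c d f <= itg a b f.
Proof.
move=> ac cd db hf f0.
rewrite (@itg_split a b c) ?ac ?(le_trans cd) //.
have hf' : itgable c b f by apply: itgableS hf.
rewrite (@itg_split c b d) ?cd //.
have h1 : 0 <= itg a c f.
  apply: itg_ge0 => x /andP[ax xc]; apply: f0; rewrite ax.
  by rewrite (le_trans xc) // (le_trans cd).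
have h2 : 0 <= itg d b f.
  apply: itg_ge0 => x /andP[dx xb]; apply: f0; rewrite xb andbT.
  by rewrite (le_trans ac) // (le_trans cd).
lra.
Qed.

(** Cauchy-Schwarz against the constant 1: integrate [(f - k)^2 >= 0] and take for [k] the mean
    value of [f]. *)
Lemma itg_sqr_le a b f : a <= b -> sq_itgable a b f ->
  itg a b f ^+ 2 <= (b - a) * itg a b (fun x => f x ^+ 2).
Proof.
rewrite le_eqVlt => /predU1P[<- _|ab hf].
  by rewrite !itg_point expr0n /= mulr0.
have if1 := sq_itgable_itgable _ _ _ hf; have [mf if2] := hf.
have ba : 0 < b - a by rewrite subr_gt0.
have ik k : itgable a b (fun=> k) by exact/bdd_meas_itgable/bdd_meas_cst.
have main k : 0 <= itg a b (fun x => f x ^+ 2)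
    + (- (2 * k) * itg a b f + k ^+ 2 * (b - a)).
  have : 0 <= itg a b (fun x => f x ^+ 2 + (- (2 * k) * f x + k ^+ 2)).
    by apply: itg_ge0 => x _; have := sqr_ge0 (f x - k); nra.
  rewrite itgD //; last by apply: itgableD; first exact: itgableZ.
  rewrite (@itgD _ _ (fun x => - (2 * k) * f x)) //; last exact: itgableZ.
  by rewrite (itgZ _ _ _ f) // itg_cst // ltW.
have := mulr_ge0 (ltW ba) (main (itg a b f / (b - a))).
move: (itg a b f) (itg a b _) => S A.
rewrite [X in 0 <= X -> _](_ : _ = (b - a) * A - S ^+ 2); first by rewrite subr_ge0.
by field; rewrite gt_eqF.
Qed.

End IntervalIntegral.

(** * H^1 functions on segments *)

Section H1Interval.
Context {R : realType}.
Local Notation leb := (@lebesgue_measure R).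
Implicit Types (a b c k p q x y : R) (f g v w dv dw : R -> R).

(** The weak derivative is carried as data and integrated over every subsegment. Restriction is then
    immediate, and [w] is its own continuous representative, so its values at cut points make
    sense. *)
Definition H1_on a b w dw :=
  sq_itgable a b dw /\
  forall x y, a <= x -> x <= y -> y <= b -> w y - w x = itg x y dw.

Lemma H1_on01 v dv : H1_01 v dv -> H1_on 0 1 v dv.
Proof.
move=> [mdv [dvoo vE]]; split => //; split => //.
apply/integrableP; split.
  by apply/measurable_EFinP; exact: measurable_funX.
by under eq_integral do rewrite /= ger0_norm ?sqr_ge0 //.
Qed.

Lemma H1_onS a b c d w dw : a <= c -> d <= b -> H1_on a b w dw -> H1_on c d w dw.
Proof.
move=> ac db [sq wE]; split; first exact: sq_itgableS sq.
by move=> x y cx xy yd; apply: wE => //; [exact: le_trans cx|exact: le_trans db].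
Qed.

Lemma H1_on_within a b w dw : a <= b -> H1_on a b w dw ->
  {within `[a, b], continuous w}.
Proof.
move=> ab [sq wE]; have idw := sq_itgable_itgable _ _ _ sq.
have cF := parameterized_integral_continuous ab idw.
apply: (@subspace_eq_continuous _ _ _ (fun x => w a + itg a x dw)).
  move=> x; rewrite inE /= in_itv /= => /andP[ax xb].
  by rewrite -wE // addrC subrK.
by move=> x; apply: cvgD; [exact: cvg_cst|exact: cF].
Qed.

Lemma H1_on_bdd a b w dw : a <= b -> H1_on a b w dw -> bdd_meas a b w.
Proof. by move=> ab /(H1_on_within _ _ _ _ ab); exact: bdd_meas_within. Qed.

Lemma H1_onD a b v dv w dw : H1_on a b v dv -> H1_on a b w dw ->
  H1_on a b (fun x => v x + w x) (fun x => dv x + dw x).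
Proof.
move=> [sv vE] [sw wE]; split; first exact: sq_itgableD.
move=> x y ax xy yb; rewrite itgD.
- by rewrite -vE // -wE //; ring.
- exact: sq_itgable_itgable (sq_itgableS _ _ _ _ _ ax yb sv).
- exact: sq_itgable_itgable (sq_itgableS _ _ _ _ _ ax yb sw).
Qed.

Lemma H1_onZ a b k w dw : H1_on a b w dw ->
  H1_on a b (fun x => k * w x) (fun x => k * dw x).
Proof.
move=> [sw wE]; split; first exact: sq_itgableZ.
move=> x y ax xy yb; rewrite itgZ.
  by rewrite -wE //; ring.
exact: sq_itgable_itgable (sq_itgableS _ _ _ _ _ ax yb sw).
Qed.

Lemma H1_onB a b v dv w dw : H1_on a b v dv -> H1_on a b w dw ->
  H1_on a b (fun x => v x - w x) (fun x => dv x - dw x).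
Proof.
move=> hv /(H1_onZ _ _ (-1)) hw; have := H1_onD _ _ _ _ _ _ hv hw.
by under eq_fun do rewrite mulN1r; under [X in H1_on _ _ _ X]eq_fun do rewrite mulN1r.
Qed.

(** Lebesgue measure is [k] times its image under [y |-> xi + k * y], because the two agree on
    half-open intervals. Only measurability of the integrand is asked for, since squares of weak
    derivatives must be rescaled too. *)
Lemma ge0_integral_affine xi k p q (f : R -> \bar R) : 0 < k ->
  measurable_fun `[xi + k * p, xi + k * q] f -> (forall x, 0 <= f x)%E ->
  (\int[leb]_(x in `[(xi + k * p)%R, (xi + k * q)%R]) f x =
   k%:E * \int[leb]_(y in `[p, q]) f (xi + k * y)%R)%E.
Proof.
move=> k0 mf f0; pose phi (y : measurableTypeR R) : measurableTypeR R := xi + k * y.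
have mphi : measurable_fun setT phi.
  apply: measurable_funD; first exact: measurable_cst.
  exact: mulrl_measurable.
have pre (c d : R) (s t : bool) : phi @^-1` [set` Interval (BSide s (xi + k * c)) (BSide t (xi + k * d))]
    = [set` Interval (BSide s c) (BSide t d)].
  apply/seteqP; split => y /=; rewrite /phi !itv_boundlr /= => /andP[h1 h2]; apply/andP;
  split; move: h1 h2; case: s; case: t; rewrite !bnd_simp ?lerD2l ?ltrD2l ?ler_pM2l ?ltr_pM2l //.
have k0' : 0 <= k by exact: ltW.
pose kn := NngNum k0'.
have muE A : measurable A -> leb A = mscale kn (pushforward leb phi) A.
  apply: lebesgue_measure_unique => _ [[c d]] _ <-.
  rewrite /= /mscale /= /pushforward.
  have kd (z : R) : xi + k * ((z - xi) / k) = z by field; rewrite gt_eqF.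
  rewrite -[in X in (_ * leb X)%E](kd c) -[in X in (_ * leb X)%E](kd d) pre.
  rewrite !lebesgue_measure_itv /= !lte_fin.
  rewrite ltr_pM2r ?invr_gt0 // ltrD2r; case: ifPn => _; last by rewrite mule0.
  by rewrite -!EFinB -EFinM; congr EFin; field; rewrite gt_eqF.
have -> : `[p, q]%classic = phi @^-1` `[xi + k * p, xi + k * q] by rewrite pre.
rewrite -[in RHS](ge0_integral_pushforward mphi) //=.
rewrite -[k%:E]/(kn%:num%:E) -ge0_integral_mscale //.
by apply: eq_measure_integral => A mA _; exact: muE.
Qed.

Lemma itgable_affine xi k p q f : 0 < k ->
  itgable (xi + k * p) (xi + k * q) f -> itgable p q (fun y => f (xi + k * y)).
Proof.
move=> k0 /integrableP[mf foo]; apply/integrableP.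
have mfk : measurable_fun `[p, q] (EFin \o (fun y => f (xi + k * y))).
  apply: (@measurable_comp _ _ _ _ _ _ `[xi + k * p, xi + k * q]) mf _ => //.
  - move=> _ [y /= yI <-]; move: yI; rewrite !in_itv /=.
    by rewrite !lerD2l !ler_pM2l.
  - apply: measurable_funD; first exact: measurable_cst.
    exact: mulrl_measurable.
split => //; move: foo.
rewrite (ge0_integral_affine xi k p q (fun x => `|(EFin \o f) x|%E)) //; last exact: measurableT_comp.
move=> foo; rewrite ltey; apply: contraTneq foo => ->.
by rewrite gt0_muley ?lte_fin.
Qed.

Lemma itg_affine xi k p q f : 0 < k -> itgable (xi + k * p) (xi + k * q) f ->
  itg (xi + k * p) (xi + k * q) f = k * itg p q (fun y => f (xi + k * y)).
Proof.
move=> k0 hf; have hfk := itgable_affine _ _ _ _ _ k0 hf.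
have mf := measurable_int _ hf.
rewrite /itg /Rintegral integralE.
rewrite (ge0_integral_affine xi k p q ((EFin \o f)^\+)%E) //; last exact: measurable_funepos.
rewrite (ge0_integral_affine xi k p q ((EFin \o f)^\-)%E) //; last exact: measurable_funeneg.
pose g y := f (xi + k * y).
transitivity (fine (k%:E * (\int[leb]_(y in `[p, q]) ((EFin \o g)^\+ y))
                  - k%:E * (\int[leb]_(y in `[p, q]) ((EFin \o g)^\- y)))%E).
  by congr (fine (_ * _ - _ * _)%E); apply: eq_integral => y _;
    rewrite ?funeposE ?funenegE.
have fng : (\int[leb]_(y in `[p, q]) ((EFin \o g) y))%E \is a fin_num.
  exact: integrable_fin_num.
have fnn : (\int[leb]_(y in `[p, q]) ((EFin \o g)^\- y))%E \is a fin_num.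
  exact: integrable_neg_fin_num.
rewrite -(@muleBr _ k%:E) //; last by apply: fin_num_adde_defl; rewrite ?fin_numN.
by rewrite -integralE fineM.
Qed.

End H1Interval.

(** * The kink profile *)

Section Profile.
Context {R : realType}.
Implicit Types x y d : R.

Let s2 : 1 <= Num.sqrt 2 :> R.
Proof. by rewrite -{1}sqrtr1 ler_wsqrtr // ler1n. Qed.

Let s2gt0 : 0 < Num.sqrt 2 :> R. Proof. by rewrite sqrtr_gt0. Qed.

Let cosh2_gt0 x : 0 < expR x + expR (- x).
Proof. by rewrite addr_gt0 ?expR_gt0. Qed.

(** The first-order equation of the profile; every later estimate on [U'] is read off from it and
    from bounds on [U]. *)
Lemma is_derive_Uprof x :
  is_derive x 1 (@Uprof R) ((1 - Uprof x ^+ 2) / Num.sqrt 2).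
Proof.
have c0 := cosh2_gt0 (x / Num.sqrt 2).
have d1 : is_derive x 1 (fun x => x / Num.sqrt 2 : R) (1 / Num.sqrt 2).
  have := is_deriveM (is_derive_id x 1) (is_derive_cst (Num.sqrt 2)^-1 x 1).
  by move=> h; apply: is_derive_eq; rewrite scaler0 add0r /GRing.scale /= mulrC.
have d2 : is_derive x 1 (fun x => - (x / Num.sqrt 2) : R) (- (1 / Num.sqrt 2)).
  exact: is_deriveN.
have e1 : is_derive x 1 (fun x => expR (x / Num.sqrt 2))
    (expR (x / Num.sqrt 2) * (1 / Num.sqrt 2)).
  exact: (is_derive1_comp (is_derive_expR _) d1).
have e2 : is_derive x 1 (fun x => expR (- (x / Num.sqrt 2)))
    (expR (- (x / Num.sqrt 2)) * - (1 / Num.sqrt 2)).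
  exact: (is_derive1_comp (is_derive_expR _) d2).
have nz : expR (x / Num.sqrt 2) + expR (- (x / Num.sqrt 2)) != 0 by rewrite gt_eqF.
have eV := @is_deriveV R (fun x => expR (x / Num.sqrt 2) + expR (- (x / Num.sqrt 2)))
  x _ 1 nz (is_deriveD e1 e2).
have eB : is_derive x 1 (fun x => expR (x / Num.sqrt 2) - expR (- (x / Num.sqrt 2))) _
  := is_deriveB e1 e2.
have := is_deriveM eB eV.
move=> h; apply: is_derive_eq.
rewrite /Uprof /tanhR /GRing.scale /=.
move: nz c0 s2gt0; set a := expR _; set b := expR _; set s := Num.sqrt 2.
by move=> nz c0 s0; field; rewrite !gt_eqF.
Qed.

Lemma derive1_Uprof x : derive1 (@Uprof R) x = (1 - Uprof x ^+ 2) / Num.sqrt 2.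
Proof. by rewrite derive1E; apply: derive_val; exact: is_derive_Uprof. Qed.

Lemma continuous_Uprof : continuous (@Uprof R).
Proof.
move=> x; apply: differentiable_continuous; apply/derivable1_diffP.
by case: (is_derive_Uprof x).
Qed.

Lemma continuous_derive1_Uprof : continuous (derive1 (@Uprof R)).
Proof.
have -> : derive1 (@Uprof R) = (fun x => (1 - Uprof x ^+ 2) / Num.sqrt 2).
  by apply/funext => x; exact: derive1_Uprof.
move=> x; apply: cvgM; last exact: cvg_cst.
apply: cvgB; first exact: cvg_cst.
by rewrite expr2; under eq_fun do rewrite expr2; apply: cvgM; exact: continuous_Uprof.
Qed.

Lemma Uprof_bound x : -1 < Uprof x < 1.
Proof.
have c0 := cosh2_gt0 (x / Num.sqrt 2).
rewrite /Uprof /tanhR ltr_pdivlMr // ltr_pdivrMr //.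
have := expR_gt0 (x / Num.sqrt 2); have := expR_gt0 (- (x / Num.sqrt 2)).
move=> *; apply/andP; split; lra.
Qed.

Lemma UprofN x : Uprof (- x) = - Uprof x.
Proof.
rewrite /Uprof /tanhR mulNr opprK -[RHS]mulNr opprB; congr (_ / _).
exact: addrC.
Qed.

(** With [z = x / sqrt 2], the left side is [2 e^-z / (e^z + e^-z)], at most [2 e^(-2 z)], and
    [2 z = sqrt 2 * x >= d]. The sharper rate [sqrt 2] is given up for a simpler exponent. *)
Lemma Uprof_right d x : 0 <= d -> d <= x -> 1 - Uprof x <= 2 * expR (- d).
Proof.
move=> d0 dx; rewrite /Uprof /tanhR; set z := x / Num.sqrt 2.
have c0 := cosh2_gt0 z.
have z2 : d <= z + z.
  rewrite /z -mulrDl ler_pdivlMr //.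
  have : Num.sqrt 2 <= 2 :> R.
    have ss : Num.sqrt 2 * Num.sqrt 2 = 2 :> R by rewrite -expr2 sqr_sqrtr.
    by rewrite -[leRHS]ss ler_peMl // ltW.
  by move: (Num.sqrt 2) => s; nra.
rewrite (_ : 1 - _ = 2 * expR (- z) / (expR z + expR (- z))); last first.
  by field; rewrite gt_eqF.
rewrite ler_pdivrMr // -mulrA ler_pM2l //.
have : expR (- z) <= expR (- d) * expR z.
  by rewrite -expRD ler_expR; lra.
have := mulr_ge0 (expR_ge0 (- d)) (expR_ge0 (- z)); lra.
Qed.

Lemma Uprof_left d x : 0 <= d -> x <= - d -> 1 + Uprof x <= 2 * expR (- d).
Proof.
move=> d0 xd; have := @Uprof_right d (- x) d0; rewrite UprofN opprK.
by apply; rewrite lerNr.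
Qed.

Lemma derive1_Uprof_ge0 x : 0 <= derive1 (@Uprof R) x.
Proof.
rewrite derive1_Uprof; have := Uprof_bound x => /andP[? ?].
by apply: divr_ge0; [nra|exact: ltW].
Qed.

Lemma derive1_Uprof_le x : derive1 (@Uprof R) x <= 1 - Uprof x ^+ 2.
Proof.
rewrite derive1_Uprof; have := Uprof_bound x => /andP[? ?].
rewrite ler_pdivrMr // ler_peMr //; nra.
Qed.

Lemma derive1_Uprof_le1 x : derive1 (@Uprof R) x <= 1.
Proof. by apply: le_trans (derive1_Uprof_le x) _; have := sqr_ge0 (Uprof x); lra. Qed.

Lemma derive1_Uprof_far d x : 0 <= d -> d <= `|x| ->
  derive1 (@Uprof R) x <= 4 * expR (- d).
Proof.
move=> d0 dx; apply: le_trans (derive1_Uprof_le x) _.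
have /andP[u1 u2] := Uprof_bound x.
move: dx; rewrite ler_normr => /orP[dx|dx].
- have := Uprof_right _ _ d0 dx; nra.
- have := Uprof_left _ x d0; rewrite -lerNr => /(_ dx); nra.
Qed.

(** Here [1 - U^2 = 4 / (e^z + e^-z)^2] with [|z| <= 1], and the denominator is at most [4 e^2]. An
    explicit positive bound is wanted because the overlap of a tent with [U'] will be divided by. *)
Lemma derive1_Uprof_near x : `|x| <= 1 ->
  expR (- 2) / Num.sqrt 2 <= derive1 (@Uprof R) x.
Proof.
move=> x1; rewrite derive1_Uprof ler_pM2r ?invr_gt0 //.
rewrite /Uprof /tanhR; set z := x / Num.sqrt 2.
have c0 := cosh2_gt0 z.
have z1 : `|z| <= 1.
  rewrite normrM normfV (gtr0_norm s2gt0) ler_pdivrMr // mul1r.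
  exact: le_trans s2.
have zz : expR z * expR (- z) = 1 by rewrite -expRD subrr expR0.
have zle : expR z <= expR 1.
  by rewrite ler_expR; apply: le_trans z1; exact: ler_norm.
have zle' : expR (- z) <= expR 1.
  by rewrite ler_expR; apply: le_trans z1; rewrite -normrN; exact: ler_norm.
have zgt := expR_gt0 z; have zgt' := expR_gt0 (- z).
rewrite (_ : 1 - _ = 4 * (expR z * expR (- z)) / (expR z + expR (- z)) ^+ 2); last first.
  by field; rewrite gt_eqF.
rewrite zz ler_pdivlMr ?exprn_gt0 //.
have : (expR z + expR (- z)) ^+ 2 <= 4 * (expR 1 * expR 1) by nra.
have -> : expR 1 * expR 1 = expR 2 :> R by rewrite -expRD.
move=> h; apply: le_trans (ler_wpM2l (expR_ge0 (- 2)) h) _.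
rewrite mulrCA -expRD (_ : -2 + 2 = 0) ?expR0; last by ring.
by rewrite mulr1.
Qed.

Lemma fAC'_Uprof x : -1 <= fAC' (Uprof x) <= (2 : R).
Proof.
rewrite /fAC'; have /andP[? ?] := Uprof_bound x.
by apply/andP; split; nra.
Qed.

End Profile.

(** * The spectral gap on a segment *)

Section ZeroExtension.
Context {R : realType}.
Local Notation leb := (@lebesgue_measure R).
Implicit Types (a b c k p q x y : R) (f g v w dv dw : R -> R).

Lemma setI_segment a b c d :
  (`[a, b] `&` `[c, d] = `[Num.max a c, Num.min b d] :> set R)%classic.
Proof.
apply/seteqP; split => x /=; rewrite !in_itv /= ge_max le_min.
  by move=> [/andP[-> ->] /andP[-> ->]].
by move=> /andP[/andP[-> ->] /andP[-> ->]].
Qed.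

Lemma gt_itg a b f : b < a -> itg a b f = 0.
Proof.
by move=> ba; rewrite /itg set_itv_ge ?Rintegral_set0 // bnd_simp -ltNge.
Qed.

(** The segment on the right may be reversed; its integral is then 0, in agreement with an empty
    intersection. *)
Lemma itg_restrict a b c d f :
  itg a b (f \_ `[c, d]) = itg (Num.max a c) (Num.min b d) f.
Proof. by rewrite /itg -Rintegral_mkcondr setI_segment. Qed.

Lemma restrict_itvE a b f x :
  (f \_ `[a, b]) x = if a <= x <= b then f x else 0.
Proof. by rewrite patchE mem_setE in_itv. Qed.

Lemma bdd_meas_fAC' a b f : bdd_meas a b f -> bdd_meas a b (fun x => fAC' (f x)).
Proof.
move=> hf; rewrite /fAC'; apply: bdd_measB; last exact: bdd_meas_cst.
by apply: bdd_measM; [exact: bdd_meas_cst|exact: bdd_measX].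
Qed.

(* Extending by zero turns a test function on [p, q] vanishing at both ends into
   one on the whole line. *)
Lemma gap_zero_ends lam0 p q w dw : spectral_gap lam0 -> p <= q ->
  H1_on p q w dw -> w p = 0 -> w q = 0 ->
  itg p q (fun x => w x * derive1 (@Uprof R) x) = 0 ->
  lam0 * itg p q (fun x => w x ^+ 2) <=
  itg p q (fun x => dw x ^+ 2 + fAC' (Uprof x) * w x ^+ 2).
Proof.
move=> gap pq hw wp wq orth.
have [sdw wE] := hw; have [mdw dw2] := sdw.
have bw := H1_on_bdd _ _ _ _ pq hw.
pose W := w \_ `[p, q]; pose dW := dw \_ `[p, q].
have fin_sq f : itgable p q (fun x => f x ^+ 2) ->
    (\int[leb]_(x in [set: R]) (((f \_ `[p, q]) x ^+ 2)%:E) < +oo)%E.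
  move=> /integrableP[_].
  under eq_integral do rewrite /= ger0_norm ?sqr_ge0 //.
  rewrite [X in (X < _)%E -> _]integral_mkcond.
  congr (_ < _)%E; apply: eq_integral => x _.
  rewrite restrict_itvE patchE mem_setE in_itv /=.
  by case: ifPn => //; rewrite expr0n.
have hW : H1_R W dW.
  split; [|split; [|split]].
  - by apply/(measurable_restrictT _ _).1.
  - exact: fin_sq.
  - by apply: fin_sq; exact/bdd_meas_itgable/bdd_measX.
  - move=> a b ab; rewrite -/(itg a b dW) itg_restrict.
    (* As [w] vanishes at both ends, its extension by zero is [w] composed with the projection onto
       [[p, q]]; increments of [W] thus become increments of [w] between points of [[p, q]]. *)
    have WE x : W x = w (Num.max p (Num.min x q)).
      rewrite /W restrict_itvE; have [xp|px] := ltP x p.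
        by rewrite min_l ?max_l ?wp // ltW // (lt_le_trans xp).
      have [xq|qx] := leP x q; first by rewrite max_r.
      by rewrite max_r.
    rewrite !WE.
    have [bp|pb] := ltP b p.
      rewrite gt_itg; last by rewrite lt_max !gt_min bp /= orbT.
      rewrite !(@min_l _ _ _ q) ?max_l ?subrr //; lra.
    case: (boolP (q < a)) => [qa|].
      rewrite gt_itg; last by rewrite lt_max !gt_min qa !orbT.
      rewrite !(@min_r _ _ _ q) ?subrr //; lra.
    rewrite -leNgt => aq.
    rewrite (@min_l _ _ a) // (@max_r _ _ p (Num.min b q)) ?le_min ?pb // maxC.
    rewrite wE //; first by rewrite le_max lexx orbT.
      by rewrite ge_max !le_min ab pb aq pq.
    by rewrite ge_min lexx orbT.
have intE f g : (forall x, ~~ (p <= x <= q) -> f x = 0) ->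
    (forall x, p <= x <= q -> f x = g x) ->
    \int[leb]_(x in [set: R]) f x = itg p q g.
  move=> f0 fg; rewrite /itg [RHS]Rintegral_mkcond; apply: eq_Rintegral => x _.
  by rewrite restrict_itvE; case: ifPn => [/fg|/f0].
have WE x : W x = if p <= x <= q then w x else 0 by exact: restrict_itvE.
have dWE x : dW x = if p <= x <= q then dw x else 0 by exact: restrict_itvE.
have := gap _ _ hW.
rewrite (intE _ (fun x => w x * derive1 (@Uprof R) x)); first last.
- by move=> x xpq; rewrite WE xpq.
- by move=> x /negbTE xpq; rewrite WE xpq mul0r.
rewrite (intE _ (fun x => -1 * (dw x ^+ 2 + fAC' (Uprof x) * w x ^+ 2))); first last.
- by move=> x xpq; rewrite WE dWE xpq; ring.
- by move=> x /negbTE xpq; rewrite WE dWE xpq; ring.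
rewrite (intE _ (fun x => w x ^+ 2)); first last.
- by move=> x xpq; rewrite WE xpq.
- by move=> x /negbTE xpq; rewrite WE xpq expr0n.
rewrite itgZ; first by move=> /(_ (or_intror orth)); lra.
apply: itgableD => //; apply: bdd_meas_itgable; apply: bdd_measM.
  by apply/bdd_meas_fAC'/bdd_meas_cont; exact: continuous_Uprof.
exact: bdd_measX.
Qed.

End ZeroExtension.

(** * Tent functions used as correctors *)

Section Hat.
Context {R : realType}.
Implicit Types (a b c x y : R).

Definition ramp c x : R := Num.max x c - c.
Definition step c x : R := (c <= x)%R%:R.

Lemma H1_on_ramp a b c : H1_on a b (ramp c) (step c).
Proof.
have stepE : step c = (cst (1 : R) : R -> R) \_ `[c, +oo[.
  apply/funext => x; rewrite /step patchE mem_setE in_itv /= andbT.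
  by case: (c <= x).
split.
  apply: bdd_meas_sq; split.
    rewrite stepE; apply/measurable_restrict => //.
  exists 1 => x _; rewrite /step; case: (c <= x); rewrite ?normr1 ?normr0 //.
move=> x y _ xy _; rewrite /itg stepE -Rintegral_mkcondr.
have -> : `[x, y]%classic `&` `[c, +oo[%classic = `[Num.max x c, y]%classic.
  apply/seteqP; split => z /=; rewrite !in_itv /= ge_max ?andbT.
    by move=> [/andP[-> ->] ->].
  by move=> /andP[/andP[-> ->] ->].
rewrite -/(itg _ _ _) /ramp.
have [cy|yc] := leP c y.
  by rewrite itg_cst ?ge_max ?xy //; ring.
rewrite gt_itg ?lt_max ?yc ?orbT // !max_r ?ltW //; lra.
Qed.

(** The tent of height 1 and half-width 1, written as a second difference of ramps so that its [H^1]
    membership and its derivative follow by linearity from a single ramp. *)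
Definition hat c x : R := ramp (c - 1) x + (-2 * ramp c x + ramp (c + 1) x).
Definition dhat c x : R := step (c - 1) x + (-2 * step c x + step (c + 1) x).

Lemma H1_on_hat a b c : H1_on a b (hat c) (dhat c).
Proof.
by apply: H1_onD; [|apply: H1_onD; [apply: H1_onZ|]]; exact: H1_on_ramp.
Qed.

Lemma hat_center c : hat c c = 1.
Proof.
rewrite /hat /ramp maxxx max_l ?max_r; lra.
Qed.

Lemma hat_far c x : 1 <= `|x - c| -> hat c x = 0.
Proof.
rewrite ler_normr /hat /ramp => /orP[h|h].
  by rewrite !max_l; lra.
by rewrite !max_r; lra.
Qed.

Lemma hat_bound c x : 0 <= hat c x <= 1.
Proof.
rewrite /hat /ramp.
have [h1|h1] := leP x (c - 1); have [h2|h2] := leP x c;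
  have [h3|h3] := leP x (c + 1); apply/andP; split; lra.
Qed.

Lemma hat_near c x : `|x - c| <= 2^-1 -> 2^-1 <= hat c x.
Proof.
rewrite ler_norml /hat /ramp => /andP[h h'].
have [h1|h1] := leP x (c - 1); have [h2|h2] := leP x c;
  have [h3|h3] := leP x (c + 1); lra.
Qed.

Lemma dhat_bound c x : `|dhat c x| <= 1.
Proof.
rewrite /dhat /step; have [h1|h1] := leP (c - 1) x; have [h2|h2] := leP c x;
  have [h3|h3] := leP (c + 1) x; rewrite ler_norml /=; apply/andP; split; lra.
Qed.

(** The inequality is strict because [step] jumps at its own point: [dhat c (c - 1)] is 1. *)
Lemma dhat_far c x : 1 < `|x - c| -> dhat c x = 0.
Proof.
rewrite /dhat /step lter_normr => /orP[h|h];
have [h1|h1] := leP (c - 1) x; have [h2|h2] := leP c x;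
  have [h3|h3] := leP (c + 1) x; rewrite /=; lra.
Qed.

(** Comparison with the indicator of [[c - 1, c + 1]]. The bound is independent of [a] and [b],
    which keeps the constant of the approximate gap uniform in the segment. *)
Lemma itg_near_le a b c f : a <= b -> itgable a b f ->
  (forall x, a <= x <= b -> f x <= 1) ->
  (forall x, a <= x <= b -> 1 < `|x - c| -> f x = 0) -> itg a b f <= 2.
Proof.
move=> ab hf f1 f0.
pose g := (fun=> 1 : R) \_ `[c - 1, c + 1].
have gE x : g x = if c - 1 <= x <= c + 1 then 1 else 0 by exact: restrict_itvE.
have hg : itgable a b g.
  apply: bdd_meas_itgable; split; first exact/measurable_restrict.
  by exists 1 => x _; rewrite gE; case: ifP; rewrite ?normr1 ?normr0.
apply: (@le_trans _ _ (itg a b g)).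
  apply: le_itg => // x xab; rewrite gE; case: ifPn => [_|xc]; first exact: f1.
  rewrite f0 //; move: xc; rewrite negb_and -!ltNge lter_normr => /orP[]h;
  apply/orP; [right|left]; lra.
rewrite itg_restrict; have [h|h] := leP (Num.max a (c - 1)) (Num.min b (c + 1)).
  rewrite itg_cst //.
  have : c - 1 <= Num.max a (c - 1) by rewrite le_max lexx orbT.
  have : Num.min b (c + 1) <= c + 1 by rewrite ge_min lexx orbT.
  lra.
by rewrite gt_itg.
Qed.

End Hat.

(** * Stability of the gap under end values and overlap *)

Section ApproximateGap.
Context {R : realType}.
Implicit Types (a b c k p q x y : R) (f g v w dv dw : R -> R).

Local Notation dU := (derive1 (@Uprof R)).

Lemma bdd_meas_dU a b : bdd_meas a b dU.
Proof. by apply: bdd_meas_cont; exact: continuous_derive1_Uprof. Qed.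

Lemma bdd_meas_hat a b c : bdd_meas a b (hat c).
Proof.
have [ab|ba] := leP a b; first exact: H1_on_bdd ab (H1_on_hat a b c).
split; first by rewrite set_itv_ge ?bnd_simp -?ltNge //; exact: measurable_fun_set0.
by exists 0 => x /andP[ax xb]; have := le_lt_trans (le_trans ax xb) ba; rewrite ltxx.
Qed.

Lemma itg_hat_dU_le p q c : p <= q -> itg p q (fun x => hat c x * dU x) ^+ 2 <= 4.
Proof.
move=> pq; have h0 : 0 <= itg p q (fun x => hat c x * dU x).
  apply: itg_ge0 => x _; have /andP[h _] := hat_bound c x.
  by rewrite mulr_ge0 // derive1_Uprof_ge0.
have : itg p q (fun x => hat c x * dU x) <= 2.
  apply: (itg_near_le _ _ c) => //.
  - by apply/bdd_meas_itgable/bdd_measM; [exact: bdd_meas_hat|exact: bdd_meas_dU].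
  - move=> x _; have /andP[? ?] := hat_bound c x.
    by have := derive1_Uprof_ge0 x; have := derive1_Uprof_le1 x; nra.
  - by move=> x _ /ltW /hat_far ->; rewrite mul0r.
move=> h2; nra.
Qed.

(** Lower bound for the overlap of the central tent with [U']: on the window [[-1/2, 1/2]], of
    length 1, the tent is at least 1/2 and [U'] at least [e^-2 / sqrt 2]. *)
Let u0 : R := expR (- 2) / Num.sqrt 2 / 2.

Let u0_gt0 : 0 < u0.
Proof. by rewrite !divr_gt0 ?expR_gt0 ?sqrtr_gt0. Qed.

Lemma itg_hat0_dU_ge p q : p <= -1 -> 1 <= q ->
  u0 <= itg p q (fun x => hat 0 x * dU x).
Proof.
move=> p1 q1.
have hM : itgable p q (fun x => hat 0 x * dU x).
  by apply/bdd_meas_itgable/bdd_measM; [exact: bdd_meas_hat|exact: bdd_meas_dU].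
have nn x : 0 <= hat 0 x * dU x.
  have /andP[? _] := hat_bound 0 x.
  by rewrite mulr_ge0 // derive1_Uprof_ge0.
apply: (@le_trans _ _ (itg (- 2^-1) 2^-1 (fun=> u0))).
  rewrite itg_cst; last by lra.
  have -> : 2^-1 - - 2^-1 = 1 :> R by field.
  by rewrite mulr1.
apply: (@le_trans _ _ (itg (- 2^-1) 2^-1 (fun x => hat 0 x * dU x))).
  apply: le_itg; first exact/bdd_meas_itgable/bdd_meas_cst.
    by apply: itgableS hM; lra.
  move=> x xh; have xh' : `|x| <= 2^-1 by rewrite ler_norml.
  have h1 : 2^-1 <= hat 0 x by apply: hat_near; rewrite subr0.
  have h2 : 2 * u0 <= dU x.
    rewrite /u0 mulrCA divff ?pnatr_eq0 // mulr1.
    by apply: derive1_Uprof_near; lra.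
  by have := ltW u0_gt0; nra.
by apply: le_itg_sub => //; lra.
Qed.

Lemma itg_hat_sq_le p q c : p <= q ->
  itg p q (fun x => hat c x ^+ 2) + itg p q (fun x => dhat c x ^+ 2) <= 4.
Proof.
move=> pq; have sq := (H1_on_hat p q c).1.
have h1 : itg p q (fun x => hat c x ^+ 2) <= 2.
  apply: (itg_near_le _ _ c) => //.
  - by apply/bdd_meas_itgable/bdd_measX; exact: bdd_meas_hat.
  - by move=> x _; have /andP[? ?] := hat_bound c x; nra.
  - by move=> x _ /ltW /hat_far ->; rewrite expr0n.
have h2 : itg p q (fun x => dhat c x ^+ 2) <= 2.
  apply: (itg_near_le _ _ c) => //.
  - by case: sq.
  - move=> x _; have := dhat_bound c x; rewrite ler_norml => /andP[? ?]; nra.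
  - by move=> x _ /dhat_far ->; rewrite expr0n.
lra.
Qed.

(* Quantitative stability of the gap: subtracting hats at the two ends and at the
   centre of the kink makes [w] an admissible test function, at a cost controlled
   by the end values and by the overlap with [U']. *)
Lemma approx_gap lam0 : 0 < lam0 -> spectral_gap lam0 -> forall delta, 0 < delta ->
  exists C, 0 < C /\ forall p q w dw, p <= -1 -> 1 <= q -> H1_on p q w dw ->
  lam0 * itg p q (fun x => w x ^+ 2) <=
    itg p q (fun x => dw x ^+ 2 + fAC' (Uprof x) * w x ^+ 2)
    + delta * (itg p q (fun x => dw x ^+ 2) + itg p q (fun x => w x ^+ 2))
    + C * (itg p q (fun x => w x * dU x) ^+ 2 + w p ^+ 2 + w q ^+ 2).
Proof.
move=> l0 gap de de0.
(* [M] bounds [|f'(U) - lam0|], since [f'(U)] lies in [[-1, 2]]. [K] collects what Young's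
   inequality with weight [de] leaves on the corrector: [1 + 1/de] on [r'^2], and [M^2/de + M] on
   [r^2]. *)
pose M := 2 + lam0.
pose K := 1 + de^-1 + M ^+ 2 / de + M.
have M0 : 0 < M by rewrite /M; lra.
have dV : 0 < de^-1 by rewrite invr_gt0.
have K0 : 0 < K.
  by rewrite /K; have := mulr_gt0 (mulr_gt0 M0 M0) dV; rewrite -expr2; lra.
pose G := 12 / u0 ^+ 2 + 1.
have G0 : 1 <= G by rewrite /G lerDr divr_ge0 // exprn_ge0 // ltW.
exists (K * (12 * G + 12)); split; first by nra.
move=> p q w dw p1 q1 hw.
have pq : p <= q by lra.
have ok c : itgable p q (fun x => hat c x * dU x).
  by apply/bdd_meas_itgable/bdd_measM; [exact: bdd_meas_hat|exact: bdd_meas_dU].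
set A := itg p q (fun x => w x * dU x).
set B0 := itg p q (fun x => hat 0 x * dU x).
set Bp := itg p q (fun x => hat p x * dU x).
set Bq := itg p q (fun x => hat q x * dU x).
have B0ge : u0 <= B0 by exact: itg_hat0_dU_ge.
have Bple : Bp ^+ 2 <= 4 by exact: itg_hat_dU_le.
have Bqle : Bq ^+ 2 <= 4 by exact: itg_hat_dU_le.
have B0gt : 0 < B0 by exact: lt_le_trans B0ge.
have sum3 (X Y s t Z : R) : X ^+ 2 <= 4 * s ^+ 2 -> Y ^+ 2 <= 4 * t ^+ 2 ->
    (Z - X - Y) ^+ 2 <= 12 * (Z ^+ 2 + s ^+ 2 + t ^+ 2).
  move=> hX hY.
  have := sqr_ge0 (Z + X); have := sqr_ge0 (Z + Y); have := sqr_ge0 (X - Y).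
  have := sqr_ge0 Z; have := sqr_ge0 s; have := sqr_ge0 t; nra.
(* The end tents, with coefficients [w p] and [w q], change the overlap with [U']; [ga] is the
   coefficient of the central tent that cancels what remains. *)
pose ga := (A - w p * Bp - w q * Bq) / B0.
have gale : ga ^+ 2 <= G * (A ^+ 2 + w p ^+ 2 + w q ^+ 2).
  have h1 : (A - w p * Bp - w q * Bq) ^+ 2 <= 12 * (A ^+ 2 + w p ^+ 2 + w q ^+ 2).
    have : (w p * Bp) ^+ 2 <= 4 * w p ^+ 2.
      by rewrite exprMn mulrC ler_wpM2r ?sqr_ge0.
    have : (w q * Bq) ^+ 2 <= 4 * w q ^+ 2.
      by rewrite exprMn mulrC ler_wpM2r ?sqr_ge0.
    by move=> hq hp; exact: sum3.
  rewrite /ga expr_div_n ler_pdivrMr ?exprn_gt0 //.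
  apply: (le_trans h1).
  have S0 : 0 <= A ^+ 2 + w p ^+ 2 + w q ^+ 2 by rewrite !addr_ge0 ?sqr_ge0.
  rewrite mulrAC ler_wpM2r //.
  have h2 : u0 ^+ 2 <= B0 ^+ 2 by rewrite ler_sqr ?nnegrE // ltW.
  have u2 : 0 < u0 ^+ 2 by rewrite exprn_gt0.
  have h3 : 12 <= G * u0 ^+ 2.
    by rewrite /G mulrDl divfK ?gt_eqF // mul1r; lra.
  by apply: le_trans h3 _; rewrite ler_wpM2l //; lra.
pose r x := w p * hat p x + (w q * hat q x + ga * hat 0 x).
pose dr x := w p * dhat p x + (w q * dhat q x + ga * dhat 0 x).
have hr : H1_on p q r dr.
  apply: H1_onD; first by apply: H1_onZ; exact: H1_on_hat.
  by apply: H1_onD; apply: H1_onZ; exact: H1_on_hat.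
have [bw br] := (H1_on_bdd _ _ _ _ pq hw, H1_on_bdd _ _ _ _ pq hr).
have hE := H1_onB _ _ _ _ _ _ hw hr.
(* The centres [p], [0], [q] are at mutual distance at least 1, so each tent vanishes at the other
   centres and the corrector takes exactly the end values of [w]. *)
have far0 c d : 1 <= `|c - d| -> hat d c = 0 by exact: hat_far.
have rp : r p = w p.
  rewrite /r hat_center (far0 p q) ?(far0 p 0); first by ring.
    by rewrite subr0 ler_normr; apply/orP; right; lra.
  by rewrite ler_normr; apply/orP; right; lra.
have rq : r q = w q.
  rewrite /r hat_center (far0 q p) ?(far0 q 0); first by ring.
    by rewrite subr0 ler_normr; apply/orP; left; lra.
  by rewrite ler_normr; apply/orP; left; lra.
have bdU := bdd_meas_dU p q.
have orth : itg p q (fun x => (w x - r x) * dU x) = 0.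
  rewrite (@eq_itg _ _ _ _ (fun x => w x * dU x - (w p * (hat p x * dU x) +
     (w q * (hat q x * dU x) + ga * (hat 0 x * dU x))))); last first.
    by move=> x _; rewrite /r; ring.
  have i1 := itgableZ _ _ (w p) _ (ok p).
  have i2 := itgableZ _ _ (w q) _ (ok q).
  have i3 := itgableZ _ _ ga _ (ok 0).
  have i4 := bdd_meas_itgable _ _ _ (bdd_measM _ _ _ _ bw bdU).
  rewrite itgB //; last by apply: itgableD => //; exact: itgableD.
  rewrite itgD //; last exact: itgableD.
  rewrite itgD // !itgZ // -/A -/Bp -/Bq -/B0 /ga divfK ?gt_eqF //; ring.
have ends : w p - r p = 0 /\ w q - r q = 0 by rewrite rp rq !subrr.
have := gap_zero_ends _ _ _ _ _ gap pq hE ends.1 ends.2 orth.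
have idw2 : itgable p q (fun x => dw x ^+ 2) by case: hw => [[]].
have idr2 : itgable p q (fun x => dr x ^+ 2) by case: hr => [[]].
have iw2 : itgable p q (fun x => w x ^+ 2) by exact/bdd_meas_itgable/bdd_measX.
have ir2 : itgable p q (fun x => r x ^+ 2) by exact/bdd_meas_itgable/bdd_measX.
have bF : bdd_meas p q (fun x => fAC' (Uprof x) : R).
  by apply/bdd_meas_fAC'/bdd_meas_cont; exact: continuous_Uprof.
have iFw2 : itgable p q (fun x => fAC' (Uprof x) * w x ^+ 2).
  by apply/bdd_meas_itgable/bdd_measM => //; exact: bdd_measX.
have bwr := bdd_measB _ _ _ _ bw br.
have idE2 : itgable p q (fun x => (dw x - dr x) ^+ 2) by case: hE => [[]].
have iFE2 : itgable p q (fun x => fAC' (Uprof x) * (w x - r x) ^+ 2).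
  by apply/bdd_meas_itgable/bdd_measM => //; exact: bdd_measX.
have iE2 : itgable p q (fun x => (w x - r x) ^+ 2).
  exact/bdd_meas_itgable/bdd_measX.
(* Energy minus [lam0] times mass is quadratic. Its cross terms [-2 w' r'] and [-2 (F - lam0) w r]
   are split pointwise by Young's inequality, leaving a share [de] on [w] and [K] on [r]. *)
have pointwise : itg p q (fun x => (dw x - dr x) ^+ 2 + fAC' (Uprof x) * (w x - r x) ^+ 2)
    - lam0 * itg p q (fun x => (w x - r x) ^+ 2) <=
  itg p q (fun x => dw x ^+ 2 + fAC' (Uprof x) * w x ^+ 2)
    - lam0 * itg p q (fun x => w x ^+ 2)
    + de * (itg p q (fun x => dw x ^+ 2) + itg p q (fun x => w x ^+ 2))
    + K * (itg p q (fun x => r x ^+ 2) + itg p q (fun x => dr x ^+ 2)).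
  have iQ := itgableD _ _ _ _ idw2 iFw2.
  have iQE := itgableD _ _ _ _ idE2 iFE2.
  have iN := itgableD _ _ _ _ idw2 iw2.
  have iNr := itgableD _ _ _ _ ir2 idr2.
  rewrite -itgZ // -itgB //; last exact: itgableZ.
  rewrite -itgZ // -itgB //; last exact: itgableZ.
  rewrite -itgD // -itgZ // -itgD //; last 2 first.
  - by apply: itgableB => //; exact: itgableZ.
  - exact: itgableZ.
  rewrite -itgD // -itgZ // -itgD //; last 2 first.
  - by apply: itgableD; [apply: itgableB => //|]; exact: itgableZ.
  - exact: itgableZ.
  apply: le_itg.
  - by apply: itgableB => //; exact: itgableZ.
  - apply: itgableD; last exact: itgableZ.
    by apply: itgableD; [apply: itgableB => //|]; exact: itgableZ.
  move=> x _; have /andP[F1 F2] := @fAC'_Uprof R x.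
  move: (fAC' _) F1 F2 (dw x) (dr x) (w x) (r x) => F F1 F2 W' R' W S.
  have y1 : - 2 * W' * R' <= de * W' ^+ 2 + R' ^+ 2 / de.
    rewrite -subr_ge0 (_ : _ - _ = (de * W' + R') ^+ 2 / de).
      by rewrite divr_ge0 ?sqr_ge0 // ltW.
    by field; rewrite gt_eqF.
  have y2 : - 2 * (F - lam0) * W * S <= de * W ^+ 2 + M ^+ 2 * S ^+ 2 / de.
    have h : (F - lam0) ^+ 2 <= M ^+ 2 by rewrite /M; nra.
    have : - 2 * (F - lam0) * W * S <= de * W ^+ 2 + (F - lam0) ^+ 2 * S ^+ 2 / de.
      rewrite -subr_ge0 (_ : _ - _ = (de * W + (F - lam0) * S) ^+ 2 / de).
        by rewrite divr_ge0 ?sqr_ge0 // ltW.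
      by field; rewrite gt_eqF.
    move/le_trans; apply; rewrite lerD2l ler_pM2r //.
    by rewrite ler_wpM2r ?sqr_ge0.
  have y3 : (F - lam0) * S ^+ 2 <= M * S ^+ 2.
    by rewrite ler_wpM2r ?sqr_ge0 // /M; lra.
  have y4 : 0 <= M ^+ 2 / de * R' ^+ 2.
    by rewrite mulr_ge0 ?sqr_ge0 // divr_ge0 ?sqr_ge0 // ltW.
  have y5 : 0 <= M * R' ^+ 2 by rewrite mulr_ge0 ?sqr_ge0 // ltW.
  have y6 : 0 <= S ^+ 2 / de by rewrite divr_ge0 ?sqr_ge0 // ltW.
  have y7 := sqr_ge0 S.
  rewrite /K; lra.
(* The factor 12 is 3, from the square of a three-term sum, times 4, from the energy and mass of one
   tent. *)
have ler2 : itg p q (fun x => r x ^+ 2) + itg p q (fun x => dr x ^+ 2) <=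
    12 * (ga ^+ 2 + w p ^+ 2 + w q ^+ 2).
  have three a b c : (a + (b + c)) ^+ 2 <= 3 * a ^+ 2 + (3 * b ^+ 2 + 3 * c ^+ 2).
    have := sqr_ge0 (a - b); have := sqr_ge0 (a - c); have := sqr_ge0 (b - c); nra.
  have comb (g : R -> R -> R) : (forall c, itgable p q (fun x => g c x ^+ 2)) ->
      itgable p q (fun x => (w p * g p x + (w q * g q x + ga * g 0 x)) ^+ 2) ->
      itg p q (fun x => (w p * g p x + (w q * g q x + ga * g 0 x)) ^+ 2) <=
      3 * w p ^+ 2 * itg p q (fun x => g p x ^+ 2) +
      (3 * w q ^+ 2 * itg p q (fun x => g q x ^+ 2) +
       3 * ga ^+ 2 * itg p q (fun x => g 0 x ^+ 2)).
    move=> ig ir.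
    have iZ k c : itgable p q (fun x => k * g c x ^+ 2) by exact: itgableZ.
    rewrite -!itgZ // -itgD // -itgD //; last exact: itgableD.
    apply: le_itg => //; first by apply: itgableD => //; exact: itgableD.
    by move=> x _; apply: le_trans (three _ _ _) _; rewrite !exprMn !mulrA.
  have c1 := comb (fun c => hat c) (fun c => bdd_meas_itgable _ _ _
    (bdd_measX _ _ _ 2 (bdd_meas_hat p q c))) ir2.
  have c2 := comb (fun c => dhat c) (fun c => (H1_on_hat p q c).1.2) idr2.
  apply: (le_trans (lerD c1 c2)).
  have e1 := itg_hat_sq_le p q p pq; have e2 := itg_hat_sq_le p q q pq.
  have e3 := itg_hat_sq_le p q 0 pq.
  have s1 := ler_wpM2l (sqr_ge0 (w p)) e1.
  have s2 := ler_wpM2l (sqr_ge0 (w q)) e2.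
  have s3 := ler_wpM2l (sqr_ge0 ga) e3.
  lra.
have Kler := ler_wpM2l (ltW K0) ler2.
have Kgale := ler_wpM2l (ltW K0) gale.
have A0 : 0 <= K * A ^+ 2 by rewrite mulr_ge0 ?sqr_ge0 // ltW.
have -> : K * (12 * G + 12) * (A ^+ 2 + w p ^+ 2 + w q ^+ 2) =
    12 * (K * (G * (A ^+ 2 + w p ^+ 2 + w q ^+ 2)))
    + 12 * (K * (w p ^+ 2 + w q ^+ 2)) + 12 * (K * A ^+ 2) by ring.
have Kler' : K * (itg p q (fun x => r x ^+ 2) + itg p q (fun x => dr x ^+ 2)) <=
    12 * (K * ga ^+ 2) + 12 * (K * (w p ^+ 2 + w q ^+ 2)).
  by apply: (le_trans Kler); rewrite le_eqVlt; apply/orP; left; apply/eqP; ring.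
move=> gapE; lra.
Qed.

End ApproximateGap.

(** * The gap around a kink of width eps *)

Section RescaledGap.
Context {R : realType}.
Implicit Types (a b c k p q x y xi eps : R) (f g v w dv dw : R -> R).

Local Notation dU := (derive1 (@Uprof R)).

Lemma continuous_rescale xi eps f : continuous f ->
  continuous (fun x => f ((x - xi) / eps)).
Proof.
move=> cf x; apply: (@continuous_comp _ _ _ (fun x => (x - xi) / eps) f); last exact: cf.
apply: cvgM; last exact: cvg_cst.
by apply: cvgB; [exact: cvg_id|exact: cvg_cst].
Qed.

Lemma itg_dU p q : p < q -> itg p q dU = Uprof q - Uprof p.
Proof.
move=> pq; rewrite /itg /Rintegral (@continuous_FTC2 _ _ (@Uprof R)) //.
- by apply: continuous_subspaceT; exact: continuous_derive1_Uprof.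
- split.
  + by move=> x _; case: (is_derive_Uprof x).
  + exact/cvg_at_right_filter/continuous_Uprof.
  + exact/cvg_at_left_filter/continuous_Uprof.
Qed.

(* Testing the gap with the constant 1 on a long interval. *)
Lemma gap_le3 (lam0 : R) : 0 < lam0 -> spectral_gap lam0 -> lam0 <= 3.
Proof.
move=> l0 gap; rewrite leNgt; apply/negP => l3.
have h0 : 0 < 2^-1 :> R by rewrite invr_gt0.
have [C [C0 H]] := @approx_gap R lam0 l0 gap 2^-1 h0.
(* On [[-T, T]] the constant 1 gives [lam0 * 2 T <= 4 T + T + 6 C]: [f'(U) <= 2], then the tolerance
   1/2, then at most 4 from the overlap and 2 from the ends. If [lam0 > 3], this forces
   [T <= 6 C]. *)
pose T := 1 + 6 * C.
have T1 : 1 <= T by rewrite /T; lra.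
have h1 : H1_on (- T) T (fun=> 1) (fun=> 0).
  split; first exact/bdd_meas_sq/bdd_meas_cst.
  by move=> x y _ xy _; rewrite itg_cst // mul0r subrr.
have := H _ _ _ _ _ _ h1; rewrite lerN2 => /(_ T1 T1).
have TT : - T <= T by lra.
under eq_itg do rewrite expr1n.
rewrite (itg_cst _ _ 1) //.
rewrite (@eq_itg R _ _ (fun=> 0 ^+ 2) (fun=> 0)); last by move=> *; rewrite expr0n.
rewrite (itg_cst _ _ 0) //.
rewrite (@eq_itg R _ _ (fun x => 1 * dU x) dU); last by move=> *; rewrite mul1r.
rewrite itg_dU; last by lra.
have hF : itg (- T) T (fun x => 0 ^+ 2 + fAC' (Uprof x) * 1 ^+ 2) <= 2 * (T - - T).
  rewrite -itg_cst //; apply: le_itg.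
  - apply: bdd_meas_itgable; apply: bdd_measD; first exact: bdd_meas_cst.
    apply: bdd_measM; last exact: bdd_meas_cst.
    by apply/bdd_meas_fAC'/bdd_meas_cont; exact: continuous_Uprof.
  - exact/bdd_meas_itgable/bdd_meas_cst.
  - by move=> x _; have /andP[_ h] := @fAC'_Uprof R x; rewrite expr0n expr1n /=; lra.
have hU : (Uprof T - Uprof (- T)) ^+ 2 <= 4.
  by have /andP[? ?] := Uprof_bound T; have /andP[? ?] := Uprof_bound (- T); nra.
have hCU := ler_wpM2l (ltW C0) hU.
have h3 : 3 * (2 * T) <= lam0 * (2 * T) by rewrite ler_wpM2r ?ltW //; lra.
move: hF hCU; set I := itg _ _ _; set Y := (_ - _) ^+ 2.
rewrite !expr1n -/T => hF hCU h.
have TE : 2 * T = 2 + 12 * C by rewrite /T; ring.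
have CE : C * (Y + 1 + 1) = C * Y + 2 * C by ring.
have lE : lam0 * (1 * (T - - T)) = lam0 * (2 * T) by ring.
rewrite CE lE in h; lra.
Qed.

Lemma H1_on_affine xi eps p q v dv : 0 < eps ->
  H1_on (xi + eps * p) (xi + eps * q) v dv ->
  H1_on p q (fun y => v (xi + eps * y)) (fun y => eps * dv (xi + eps * y)).
Proof.
move=> e0 [sdv vE].
have idv := itgable_affine _ _ _ _ _ e0 (sq_itgable_itgable _ _ _ sdv).
have idv2 := itgable_affine _ _ _ _ _ e0 sdv.2.
have sdv' : sq_itgable p q (fun y => dv (xi + eps * y)).
  by split => //; exact: itgable_meas.
split; first exact: sq_itgableZ.
move=> x y px xy yq.
have [h1 h2 h3] : [/\ xi + eps * p <= xi + eps * x, xi + eps * x <= xi + eps * y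
  & xi + eps * y <= xi + eps * q] by rewrite !lerD2l !ler_pM2l.
rewrite vE // itg_affine //; last first.
  by apply: itgableS (sq_itgable_itgable _ _ _ sdv).
by rewrite itgZ //; exact: itgableS idv.
Qed.

(** Substitute [x = xi + eps * y] and multiply by [eps]. An overlap integral in [x] is [eps] times
    that in [y], so its square gets the weight [1 / eps], while point values get [eps]. The constant
    is unchanged, hence independent of [eps], the kink and the segment. *)
Lemma approx_gap_rescaled (lam0 : R) : 0 < lam0 -> spectral_gap lam0 ->
  forall delta, 0 < delta ->
  exists C, 0 < C /\ forall xi eps a b v dv, 0 < eps ->
  a <= xi - eps -> xi + eps <= b -> H1_on a b v dv ->
  lam0 * itg a b (fun x => v x ^+ 2) <=
    eps ^+ 2 * itg a b (fun x => dv x ^+ 2)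
    + itg a b (fun x => fAC' (Uprof ((x - xi) / eps)) * v x ^+ 2)
    + delta * (eps ^+ 2 * itg a b (fun x => dv x ^+ 2) + itg a b (fun x => v x ^+ 2))
    + C * (itg a b (fun x => v x * dU ((x - xi) / eps)) ^+ 2 / eps
           + eps * v a ^+ 2 + eps * v b ^+ 2).
Proof.
move=> l0 gap de de0; have [C [C0 H]] := approx_gap _ l0 gap _ de0.
exists C; split => // xi eps a b v dv e0 axi xib hv.
have en0 : eps != 0 by rewrite gt_eqF.
pose p := (a - xi) / eps; pose q := (b - xi) / eps.
have aE : xi + eps * p = a by rewrite /p; field.
have bE : xi + eps * q = b by rewrite /q; field.
have ab : a <= b by lra.
have p1 : p <= -1 by rewrite /p ler_pdivrMr //; lra.
have q1 : 1 <= q by rewrite /q ler_pdivlMr //; lra.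
have bv := H1_on_bdd _ _ _ _ ab hv.
have cU := continuous_rescale xi eps _ (@continuous_Uprof R).
have cdU := continuous_rescale xi eps _ (@continuous_derive1_Uprof R).
have hv' : H1_on (xi + eps * p) (xi + eps * q) v dv by rewrite aE bE.
have hw := H1_on_affine _ _ _ _ _ _ e0 hv'.
have hg := H _ _ _ _ p1 q1 hw.
have scal f : itgable a b f -> itg a b f = eps * itg p q (fun y => f (xi + eps * y)).
  by move=> hf; rewrite -itg_affine // ?aE ?bE.
have idv2 : itgable a b (fun x => dv x ^+ 2) by case: hv => [[]].
have iv2 : itgable a b (fun x => v x ^+ 2) by exact/bdd_meas_itgable/bdd_measX.
have iF : itgable a b (fun x => fAC' (Uprof ((x - xi) / eps)) * v x ^+ 2).
  apply: bdd_meas_itgable; apply: bdd_measM; last exact: bdd_measX.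
  exact/bdd_meas_fAC'/bdd_meas_cont.
have ivU : itgable a b (fun x => v x * dU ((x - xi) / eps)).
  by apply: bdd_meas_itgable; apply: bdd_measM => //; exact: bdd_meas_cont.
have simp y : (xi + eps * y - xi) / eps = y by field.
rewrite (scal _ idv2) (scal _ iv2) (scal _ iF) (scal _ ivU).
under [X in _ + eps * X + _]eq_itg do rewrite simp.
under [X in (eps * X) ^+ 2]eq_itg do rewrite simp.
have idw : itgable p q (fun y => dv (xi + eps * y) ^+ 2).
  by apply: (itgable_affine xi eps p q (fun x => dv x ^+ 2)) => //; rewrite aE bE.
have dwE : itg p q (fun y => (eps * dv (xi + eps * y)) ^+ 2) =
    eps ^+ 2 * itg p q (fun y => dv (xi + eps * y) ^+ 2).
  by rewrite -itgZ //; apply: eq_itg => y _; rewrite exprMn.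
move: hg; rewrite itgD.
- rewrite dwE aE bE.
  move: (itg _ _ _) (itg _ _ _) (itg _ _ _) (itg _ _ _) => V D F A hg.
  have := ler_wpM2l (ltW e0) hg.
  congr (_ <= _); first by ring.
  by field.
- by case: hw => [[]].
- have := itgable_affine xi eps p q (fun x => fAC' (Uprof ((x - xi) / eps)) * v x ^+ 2) e0.
  by rewrite aE bE => /(_ iF); apply: eq_itgable => y _; rewrite simp.
Qed.

End RescaledGap.

(** * Pointwise bounds and smallness in eps *)

Section Pointwise.
Context {R : realType}.
Implicit Types (a b c d k r s x y eps : R) (v dv : R -> R).

(** The minimum of [v^2] on [[c, d]] is at most its mean, and continuity of [v] ensures that it is
    attained. *)
Lemma cut_point a b c d v : a <= c -> c < d -> d <= b ->
  {within `[a, b], continuous v} ->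
  exists x, c <= x <= d /\ (d - c) * v x ^+ 2 <= itg a b (fun x => v x ^+ 2).
Proof.
move=> ac cd db cv.
have cv' : {within `[c, d], continuous (fun x => v x ^+ 2)}.
  have sub : `[c, d]%classic `<=` `[a, b]%classic.
    by apply: subset_itv; rewrite bnd_simp.
  have cvcd := continuous_subspaceW sub cv.
  rewrite (_ : (fun x => v x ^+ 2) = (fun x => v x * v x)); last first.
    by apply/funext => x; rewrite expr2.
  by move=> x; apply: cvgM; exact: cvcd.
have [x xcd xmin] := EVT_min (ltW cd) cv'.
exists x; split; first by move: xcd; rewrite in_itv.
have bv := bdd_meas_within _ _ _ cv.
have iv2 : itgable a b (fun x => v x ^+ 2) by exact/bdd_meas_itgable/bdd_measX.
apply: (@le_trans _ _ (itg c d (fun x => v x ^+ 2))).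
  rewrite mulrC -(itg_cst _ _ _ (ltW cd)); apply: le_itg.
  - exact/bdd_meas_itgable/bdd_meas_cst.
  - exact: itgableS iv2.
  - by move=> y ycd; apply: xmin; rewrite in_itv.
by apply: le_itg_sub => // ; [exact: ltW|move=> y _; exact: sqr_ge0].
Qed.

Lemma H1_on_incr_sqr a b v dv x y : H1_on a b v dv -> a <= x -> x <= y -> y <= b ->
  (v y - v x) ^+ 2 <= (y - x) * itg a b (fun x => dv x ^+ 2).
Proof.
move=> [sdv vE] ax xy yb; rewrite vE //.
have sdv' := sq_itgableS _ _ _ _ _ ax yb sdv.
apply: le_trans (itg_sqr_le _ _ _ xy sdv') _.
rewrite ler_wpM2l ?subr_ge0 //; apply: le_itg_sub => //; first by case: sdv.
by move=> z _; exact: sqr_ge0.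
Qed.

(** Within distance [s] of [x] some [y] has [v y ^ 2] at most the mean over a window of length [s];
    the increment from [y] to [x] is controlled by Cauchy-Schwarz. As [s <= 1/2], the window fits on
    one side of [x]. *)
Lemma H1_on01_sup v dv s x : H1_on 0 1 v dv -> 0 < s <= 2^-1 -> 0 <= x <= 1 ->
  v x ^+ 2 <= 2 * (itg 0 1 (fun x => v x ^+ 2) / s
                   + s * itg 0 1 (fun x => dv x ^+ 2)).
Proof.
move=> hv /andP[s0 s2] /andP[x0 x1].
have cv := H1_on_within _ _ _ _ ler01 hv.
have D0 : 0 <= itg 0 1 (fun x => dv x ^+ 2) by apply: itg_ge0 => y _; exact: sqr_ge0.
have [y [y01 h1 h2]] : exists y, [/\ 0 <= y <= 1,
    s * v y ^+ 2 <= itg 0 1 (fun x => v x ^+ 2) &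
    (v x - v y) ^+ 2 <= s * itg 0 1 (fun x => dv x ^+ 2)].
  have [xs|xs] := leP x 2^-1.
    have [||||y [/andP[xy yxs]]] := @cut_point 0 1 x (x + s) v; try lra.
      exact: cv.
    rewrite addrAC subrr add0r => vy; exists y; split => //; first by lra.
    rewrite -sqrrN opprB.
    apply: le_trans (H1_on_incr_sqr _ _ _ _ _ _ hv x0 xy _) _; first by lra.
    by rewrite ler_wpM2r //; lra.
  have [||||y [/andP[xy yxs]]] := @cut_point 0 1 (x - s) x v; try lra.
    exact: cv.
  rewrite opprB addrCA subrr addr0 => vy; exists y; split => //; first by lra.
  apply: le_trans (H1_on_incr_sqr _ _ _ _ _ _ hv _ yxs x1) _; first by lra.
  by rewrite ler_wpM2r //; lra.
have h3 : v y ^+ 2 <= itg 0 1 (fun x => v x ^+ 2) / s by rewrite ler_pdivlMr // mulrC.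
have := sqr_ge0 (v x - 2 * v y); nra.
Qed.

End Pointwise.

Section SmallEps.
Context {R : realType}.
Implicit Types (c k r s eps : R) (P Q : R -> Prop).

Definition small_eps P := exists e0 : R, 0 < e0 /\ forall eps, 0 < eps < e0 -> P eps.

Lemma small_epsI P Q : small_eps P -> small_eps Q ->
  small_eps (fun eps => P eps /\ Q eps).
Proof.
move=> [e [e0 eP]] [d [d0 dQ]]; exists (Num.min e d); split; first by rewrite lt_min e0.
by move=> x /andP[x0]; rewrite lt_min => /andP[xe xd]; split; [apply: eP|apply: dQ];
  rewrite x0.
Qed.

Lemma small_eps_lt r : 0 < r -> small_eps (fun eps => eps < r).
Proof. by move=> r0; exists r; split => // x /andP[]. Qed.

Lemma small_eps_powR s r : 0 < s -> 0 < r -> small_eps (fun eps => eps `^ s <= r).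
Proof.
move=> s0 r0; exists (r `^ s^-1); split; first exact: powR_gt0.
move=> x /andP[x0 xr].
have -> : r = (r `^ s^-1) `^ s by rewrite -powRrM mulVf ?gt_eqF // powRr1 // ltW.
by apply: ge0_ler_powR; rewrite ?nnegrE ?powR_ge0 ?ltW.
Qed.

(** From [e^y >= y^(n+1) / (n+1)!] with [y = c / eps^k]; the choice of [n] gives [k (n+1) >= 1], so
    that [eps^(k (n+1)) <= eps]. One power of [eps] is all that is needed of the exponentially small
    terms. *)
Lemma expR_powR_le c k : 0 < c -> 0 < k ->
  exists K, 0 < K /\ forall eps, 0 < eps < 1 -> expR (- (c / eps `^ k)) <= K * eps.
Proof.
move=> c0 k0; pose n := Num.truncn k^-1.
exists (n.+1`!%:R / c ^+ n.+1); split.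
  by rewrite divr_gt0 ?exprn_gt0 // ltr0n fact_gt0.
move=> x /andP[x0 x1].
have xk0 : 0 < x `^ k by exact: powR_gt0.
have y0 : 0 < c / x `^ k by rewrite divr_gt0.
have fn : 0 < n.+1`!%:R :> R by rewrite ltr0n fact_gt0.
have h : (c / x `^ k) ^+ n.+1 / n.+1`!%:R <= expR (c / x `^ k).
  by have := expR_ge1Dxn n (ltW y0); lra.
rewrite expRN -[leRHS]invrK lef_pV2 ?posrE ?expR_gt0 //; last first.
  by rewrite invr_gt0 mulr_gt0 // divr_gt0 // exprn_gt0.
apply: le_trans h.
have c1 : 0 < c ^+ n.+1 by rewrite exprn_gt0.
have y1 : 0 < (x `^ k) ^+ n.+1 by rewrite exprn_gt0.
rewrite expr_div_n.
rewrite (_ : (_ * x)^-1 = c ^+ n.+1 / n.+1`!%:R * x^-1); last first.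
  by field; rewrite !gt_eqF.
rewrite [leRHS]mulrAC.
rewrite ler_pM2l ?divr_gt0 // lef_pV2 ?posrE //.
rewrite -powR_mulrn ?powR_ge0 // -powRrM.
rewrite -[leRHS](powRr1 (ltW x0)).
apply: ger_powR; first by rewrite x0 ltW.
have : k^-1 < n.+1%:R by rewrite /n; exact: truncnS_gt.
by move=> /ltW; rewrite -(ler_pM2l k0) divff ?gt_eqF.
Qed.

End SmallEps.

(** * Derivatives with respect to the kink positions *)

Section PositionDerivative.
Context {R : realType}.
Variables (N : nat).
Implicit Types (eps x t kappa : R) (h v : 'rV[R]_N.+1).

(** The difference quotients are literally the same; this brings the one-variable chain rule to
    directional derivatives in [h]. *)
Lemma is_derive_line (V : normedModType R) (F : V -> R) (a v : V) (d : R) :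
  is_derive (0 : R) 1 (fun t : R => F (t *: v + a)) d -> is_derive a v F d.
Proof.
have E : (fun t : R => t^-1 *: ((F \o shift a) (t *: v) - F a)) =
    (fun t : R => t^-1 *: (((fun t : R => F (t *: v + a)) \o shift 0) (t *: (1 : R))
       - (fun t : R => F (t *: v + a)) 0)).
  apply/funext => t /=; rewrite addr0 scale0r add0r.
  by rewrite (_ : t *: (1 : R) = t) //; exact: mulr1.
move=> [d1 d2]; split; first by move: d1; rewrite /derivable E.
by move: d2; rewrite /derive E.
Qed.

Lemma is_derive_Ushift eps (s x : R) h (i k : 'I_N.+1) :
  is_derive h (delta_mx 0 i) (fun h' : 'rV[R]_N.+1 => Ushift eps (h' 0 k) s x)
    (- ((k == i)%:R * s / eps * derive1 (@Uprof R) ((x - h 0 k) / eps))).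
Proof.
apply: is_derive_line.
have -> : (fun t : R => Ushift eps ((t *: delta_mx 0 i + h) 0 k) s x) =
    (fun t : R => s *: (@Uprof R \o (fun t => (- ((k == i)%:R / eps)) * t + (x - h 0 k) / eps)) t).
  apply/funext => t; rewrite /Ushift !mxE eqxx /=; congr (_ * Uprof _); ring.
have lin : is_derive (0 : R) 1
    (fun t : R => (- ((k == i)%:R / eps)) * t + (x - h 0 k) / eps) (- ((k == i)%:R / eps)).
  have h1 := is_deriveZ (- ((k == i)%:R / eps)) (is_derive_id (0 : R) 1).
  have h2 := is_deriveD h1 (is_derive_cst ((x - h 0 k) / eps) (0 : R) 1).
  by apply: is_derive_eq h2 _; rewrite addr0 /GRing.scale /= mulr1.
have U := is_derive1_comp (is_derive_Uprof _) lin.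
apply: is_derive_eq (is_deriveZ s U) _.
rewrite derive1_Uprof /GRing.scale /= mulr0 add0r; ring.
Qed.

Lemma uhi_split (beta : R -> 'rV[R]_N.+1 -> R -> R) eps h (i : 'I_N.+1) x :
  derivable (fun h' => beta eps h' x) h (delta_mx 0 i) ->
  uhi beta eps h i x = - ((-1) ^+ i / eps) * derive1 (@Uprof R) ((x - h 0 i) / eps)
    + 'D_(delta_mx 0 i) (fun h' => beta eps h' x) h.
Proof.
move=> dbeta; rewrite /uhi.
have S := is_derive_sum (fun k : 'I_N.+1 => is_derive_Ushift eps ((-1) ^+ k) x h i k).
have B := @is_deriveD _ _ _ _ _ _ _ _ _ S (DeriveDef dbeta erefl).
rewrite (_ : (fun h' => uh beta eps h' x) = (\sum_(k < N.+1)
  (fun h' : 'rV[R]_N.+1 => Ushift eps (h' 0 k) ((-1) ^+ k) x)) + (fun h' => beta eps h' x)); last first.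
  by apply/funext => h'; rewrite /uh /= fct_sumE.
have [_ ->] := B; congr (_ + _).
rewrite (bigD1 i) //= eqxx mul1r big1 ?addr0 ?mulNr //.
by move=> k /negbTE ->; rewrite !mul0r oppr0.
Qed.

Lemma cvg_row_line h v (j : 'I_N.+1) :
  (fun t : R => (t *: v + h) 0 j) @ (0 : R) --> h 0 j.
Proof.
rewrite (_ : (fun t : R => _) = (fun t : R => t * v 0 j + h 0 j)); last first.
  by apply/funext => t; rewrite !mxE.
rewrite -[X in _ --> X]add0r -[X in _ --> X + _](mul0r (v 0 j)).
apply: cvgD; last exact: cvg_cst.
by apply: cvgM; [exact: cvg_id|exact: cvg_cst].
Qed.

Lemma cvg_hext_line h v (k : nat) :
  (fun t : R => hext (t *: v + h) k) @ (0 : R) --> hext h k.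
Proof.
rewrite /hext /hcoord; case: ifP => _; first by apply: cvgN; exact: cvg_row_line.
case: ifP => _; first exact: cvg_row_line.
by apply: cvgB; [exact: cvg_cst|exact: cvg_row_line].
Qed.

Lemma Omega_near kappa eps h v : Omega kappa eps h ->
  \forall t \near (0 : R), Omega kappa eps (t *: v + h).
Proof.
move=> [h0 [hj [hN hgap]]].
have n1 : \forall t \near (0 : R), 0 < hcoord (t *: v + h) 0.
  exact: (cvgr_gt _ (cvg_row_line h v _)).
have n2 : \forall t \near (0 : R), forall j : 'I_N,
    hcoord (t *: v + h) j < hcoord (t *: v + h) j.+1.
  apply: (@filter_forall _ _ _ _ (nbhs_filter (0 : R))) => j.
  have c : (fun t : R => hcoord (t *: v + h) j.+1 - hcoord (t *: v + h) j) @ (0 : R) -->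
      hcoord h j.+1 - hcoord h j by apply: cvgB; exact: cvg_row_line.
  have hj0 : 0 < hcoord h j.+1 - hcoord h j by rewrite subr_gt0; exact: hj.
  by apply: filterS (cvgr_gt _ c _ hj0) => t /=; rewrite subr_gt0.
have n3 : \forall t \near (0 : R), hcoord (t *: v + h) N < 1.
  exact: (cvgr_lt _ (cvg_row_line h v _)).
have n4 : \forall t \near (0 : R), forall k : 'I_N.+2,
    eps / (eps `^ kappa) < `|hext (t *: v + h) k.+1 - hext (t *: v + h) k|.
  apply: (@filter_forall _ _ _ _ (nbhs_filter (0 : R))) => k.
  have c : (fun t : R => `|hext (t *: v + h) k.+1 - hext (t *: v + h) k|) @ (0 : R) -->
      `|hext h k.+1 - hext h k|.
    by apply: cvg_norm; apply: cvgB; exact: cvg_hext_line.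
  by apply: (cvgr_gt _ c); exact: hgap (ltn_ord k).
near=> t; split; [|split; [|split]].
- by near: t.
- move=> j jN; have : forall j : 'I_N, hcoord (t *: v + h) j < hcoord (t *: v + h) j.+1.
    by near: t.
  by move=> /(_ (Ordinal jN)).
- by near: t.
- move=> k kN; have : forall k : 'I_N.+2,
      eps / (eps `^ kappa) < `|hext (t *: v + h) k.+1 - hext (t *: v + h) k| by near: t.
  by move=> /(_ (Ordinal (kN : (k < N.+2)%N))).
Unshelve. all: by end_near. Qed.

(* [Omega] is open, so the difference quotients are eventually continuous in [x]. *)
Lemma bdd_meas_Dbeta (beta : R -> 'rV[R]_N.+1 -> R -> R) kappa eps h (i : 'I_N.+1) M :
  Omega kappa eps h ->
  (forall h', Omega kappa eps h' -> forall x, derivable (beta eps h') x 1) ->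
  (forall x, derivable (fun h' => beta eps h' x) h (delta_mx 0 i)) ->
  (forall x, 0 <= x <= 1 -> `|'D_(delta_mx 0 i) (fun h' => beta eps h' x) h| <= M) ->
  bdd_meas 0 1 (fun x => 'D_(delta_mx 0 i) (fun h' => beta eps h' x) h).
Proof.
move=> hO dx dh bM; split; last by exists M.
have [e /= e0 eO] := Omega_near _ _ _ (delta_mx 0 i) hO.
have [n0 n0e] : exists n0 : nat, forall n, (n0 <= n)%N -> n.+1%:R^-1 < e.
  exists (Num.truncn e^-1) => n n0n; rewrite -[ltRHS]invrK ltf_pV2 ?posrE ?invr_gt0 //.
  by apply: lt_le_trans (truncnS_gt _) _; rewrite ler_nat.
(* The shift by [n0] keeps every displaced position in [Omega], not just almost all, so each
   difference quotient is measurable. *)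
pose t n : R := (n + n0).+1%:R^-1.
have t0 n : 0 < t n by rewrite invr_gt0.
have tO n : Omega kappa eps (t n *: delta_mx 0 i + h).
  apply: eO; rewrite /= sub0r normrN gtr0_norm //; exact: n0e (leq_addl _ _).
have tcvg : t @ \oo --> (0 : R).
  by have := @cvg_harmonic R; rewrite -(cvg_shiftn n0).
have mb h' : Omega kappa eps h' -> measurable_fun `[0 : R, 1] (beta eps h').
  move=> hO'; apply: measurable_funTS; apply: continuous_measurable_fun => x.
  by apply: differentiable_continuous; apply/derivable1_diffP; exact: dx.
apply: (@measurable_fun_cvg _ _ _ _
  (fun n x => (t n)^-1 * (beta eps (t n *: delta_mx 0 i + h) x - beta eps h x))).
  move=> n; apply: measurable_funM; first exact: measurable_cst.
  by apply: measurable_funB; apply: mb.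
move=> x _.
have hr : (fun s : R => s^-1 *: (((fun h' => beta eps h' x) \o shift h) (s *: delta_mx 0 i)
     - beta eps h x)) @ (0 : R)^'+ --> 'D_(delta_mx 0 i) (fun h' => beta eps h' x) h.
  by apply: cvg_dnbhs_at_right; exact: dh.
by have /(_ t (conj t0 tcvg)) := (cvg_at_rightP _ _ _).1 hr.
Qed.

End PositionDerivative.

(** * Splitting at the cut points *)

Section Pieces.
Context {R : realType}.
Implicit Types (x y eps lam : R).
Local Notation dU := (derive1 (@Uprof R)).

(** The kink sum with the first [j] kinks saturated at 1 and the others at -1. For [n = N + 1] the
    constant [cN] cancels the first term on the right, leaving the pure phase [-(-1)^j]. *)
Lemma alternating_sign_sum n j : (j <= n)%N ->
  \sum_(k < n) (-1) ^+ k * (if (k < j)%N then 1 else -1) =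
  (1 + (-1) ^+ n) / 2 - (-1) ^+ j :> R.
Proof.
elim: n j => [|n ih] j; first by rewrite leqn0 => /eqP ->; rewrite big_ord0 expr0; lra.
rewrite leq_eqVlt => /predU1P[->|jn]; rewrite big_ord_recr /=.
  rewrite ltnSn (eq_bigr (fun k : 'I_n => (-1) ^+ k * (if (k < n)%N then 1 else -1))).
    by rewrite ih // !exprS; lra.
  by move=> k _; rewrite ltn_ord ltnS ltnW.
by rewrite ih // ltnNge -ltnS jn exprS /=; lra.
Qed.

Lemma sign_sum_dist n (F G : 'I_n -> R) e : (forall k, `|F k - G k| <= e) ->
  `|\sum_(k < n) (-1) ^+ k * F k - \sum_(k < n) (-1) ^+ k * G k| <= n%:R * e.
Proof.
move=> FG; rewrite -sumrB; apply: le_trans (ler_norm_sum _ _ _) _.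
rewrite mulr_natl -[X in _ *+ X](card_ord n) -sumr_const; apply: ler_sum => k _.
by rewrite -mulrBr normrM normrX normrN1 expr1n mul1r.
Qed.

Lemma Uprof_sign d x (b : bool) : 0 <= d -> (if b then d <= x else x <= - d) ->
  `|Uprof x - (if b then 1 else -1)| <= 2 * expR (- d).
Proof.
move=> d0; have /andP[u1 u2] := Uprof_bound x; case: b => h.
  by have := Uprof_right _ _ d0 h; rewrite ler_norml => ?; apply/andP; split; lra.
by have := Uprof_left _ _ d0 h; rewrite ler_norml => ?; apply/andP; split; lra.
Qed.

(** [j] counts the kinks to the left of [x]; replacing every kink by its limit costs [2 e^-d] each,
    and [beta] differs from [cN] by at most [M]. *)
Lemma uh_far N (beta : R -> 'rV[R]_N.+1 -> R -> R) eps (h : 'rV[R]_N.+1) x d M j :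
  0 <= d -> (j <= N.+1)%N -> `|beta eps h x - cN R N| <= M ->
  (forall k : 'I_N.+1, if (k < j)%N then d <= (x - h 0 k) / eps
                       else (x - h 0 k) / eps <= - d) ->
  `|uh beta eps h x + (-1) ^+ j| <= N.+1%:R * (2 * expR (- d)) + M.
Proof.
move=> d0 jN bM hk.
have D := @sign_sum_dist N.+1 (fun k => Uprof ((x - h 0 k) / eps))
  (fun k => if (k < j)%N then 1 else -1) _ (fun k => Uprof_sign _ _ _ d0 (hk k)).
rewrite alternating_sign_sum // in D.
apply: le_trans (lerD D bM); apply: le_trans (ler_normD _ _).
by rewrite /uh /Ushift /cN exprS le_eqVlt; apply/orP; left; apply/eqP; congr `|_|; field.
Qed.

Lemma uh_near_kink N (beta : R -> 'rV[R]_N.+1 -> R -> R) eps (h : 'rV[R]_N.+1) x d M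
    (i : 'I_N.+1) :
  0 <= d -> `|beta eps h x - cN R N| <= M ->
  (forall k : 'I_N.+1, (k < i)%N -> d <= (x - h 0 k) / eps) ->
  (forall k : 'I_N.+1, (i < k)%N -> (x - h 0 k) / eps <= - d) ->
  `|uh beta eps h x - (-1) ^+ i * Uprof ((x - h 0 i) / eps)|
    <= N.+1%:R * (2 * expR (- d)) + M.
Proof.
move=> d0 bM hl hr.
pose G (k : 'I_N.+1) : R := if k == i then Uprof ((x - h 0 i) / eps)
  else if (k < i)%N then 1 else -1.
have D : `|\sum_(k < N.+1) (-1) ^+ k * Uprof ((x - h 0 k) / eps)
    - \sum_(k < N.+1) (-1) ^+ k * G k| <= N.+1%:R * (2 * expR (- d)).
  apply: sign_sum_dist => k; rewrite /G; case: eqP => [->|/eqP ki].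
    by rewrite subrr normr0 mulr_ge0 ?expR_ge0.
  apply: Uprof_sign => //; case: ifPn => [|]; first exact: hl.
  by rewrite -leqNgt => ik; apply: hr; rewrite ltn_neqAle ik andbT eq_sym.
have GE : \sum_(k < N.+1) (-1) ^+ k * G k =
    (-1) ^+ i * Uprof ((x - h 0 i) / eps) - cN R N.
  (* Taken at [j = i], the sum counts the [i]-th kink as -1, which accounts exactly for the term
     [-(-1)^i]; the other kinks therefore add up to [- cN]. *)
  have := @alternating_sign_sum N.+1 i (ltnW (ltn_ord i)).
  have -> : cN R N = - ((1 + (-1) ^+ N.+1) / 2) by rewrite /cN exprS; field.
  rewrite (bigD1 i) //= ltnn => E; rewrite (bigD1 i) //= {1}/G eqxx.
  rewrite (eq_bigr (fun k : 'I_N.+1 => (-1) ^+ k * (if (k < i)%N then 1 else -1))).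
    by move: E; set S := \sum_(k < _ | _) _; lra.
  by move=> k /negbTE ki; rewrite /G ki.
rewrite GE in D.
apply: le_trans (lerD D bM); apply: le_trans (ler_normD _ _).
by rewrite /uh /Ushift le_eqVlt; apply/orP; left; apply/eqP; congr `|_|; ring.
Qed.

(** [f'] is even, so the sign of the kink drops out: the difference is [3 (u - s w) (u + s w)], with
    last factor at most 3 in modulus. *)
Lemma fAC'_near_kink (u s w e : R) : s ^+ 2 = 1 -> -1 <= w <= 1 -> 0 <= e <= 1 ->
  `|u - s * w| <= e -> `|fAC' u - fAC' w| <= 9 * e.
Proof.
move=> s1 /andP[w1 w2] /andP[e0 e1] h.
have -> : fAC' u - fAC' w = 3 * ((u - s * w) * (u + s * w)).
  by rewrite /fAC' -subr_sqr exprMn s1; ring.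
have sw : `|s * w| <= 1.
  have -> : `|s * w| = `|w|.
    by rewrite normrM; have /eqP := s1; rewrite sqrf_eq1 => /orP[]/eqP ->;
      rewrite ?normrN1 ?normr1 mul1r.
  by rewrite ler_norml w1.
have h2 : `|u + s * w| <= 3.
  have -> : u + s * w = (u - s * w) + (s * w + s * w) by ring.
  apply: le_trans (ler_normD _ _) _; have := ler_normD (s * w) (s * w); lra.
rewrite !normrM (ger0_norm (_ : 0 <= 3)) //.
have := ler_pM (normr_ge0 _) (normr_ge0 _) h h2; lra.
Qed.

(** Since [u^2 >= 1 - 2 e], a loss of [6 e] would suffice; 9 matches the bound near a kink. *)
Lemma fAC'_far (u s e : R) : s ^+ 2 = 1 -> 0 <= e -> `|u + s| <= e ->
  2 - 9 * e <= fAC' u.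
Proof.
move=> s1 e0; rewrite ler_norml => /andP[h1 h2]; rewrite /fAC'.
have /eqP := s1; rewrite sqrf_eq1 => /orP[]/eqP sE; rewrite sE in h1 h2; nra.
Qed.

(** The factor 5/8 is what the end pieces allow: [5/8 * 3 = 2 - 1/8 <= 2 - rho]. The kink pieces
    offer the full [lam], at the price of the error [C * e] each. *)
Lemma pieces_coercive lam delta rho C eps (n : nat) (h m : nat -> R) (u v dv : R -> R) e :
  0 < lam <= 3 -> 0 <= rho <= 8^-1 -> 0 <= delta -> 0 <= C -> 0 < eps ->
  (forall xi eps a b v dv, 0 < eps -> a <= xi - eps -> xi + eps <= b -> H1_on a b v dv ->
    lam * itg a b (fun x => v x ^+ 2) <=
    eps ^+ 2 * itg a b (fun x => dv x ^+ 2)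
    + itg a b (fun x => fAC' (Uprof ((x - xi) / eps)) * v x ^+ 2)
    + delta * (eps ^+ 2 * itg a b (fun x => dv x ^+ 2) + itg a b (fun x => v x ^+ 2))
    + C * (itg a b (fun x => v x * dU ((x - xi) / eps)) ^+ 2 / eps
           + eps * v a ^+ 2 + eps * v b ^+ 2)) ->
  (forall i, (i < n)%N -> m i <= h i - eps /\ h i + eps <= m i.+1) ->
  0 <= m 0 -> m n <= 1 -> H1_on 0 1 v dv -> bdd_meas 0 1 u ->
  (forall i, (i < n)%N -> forall x, m i <= x <= m i.+1 ->
     `|fAC' (u x) - fAC' (Uprof ((x - h i) / eps))| <= rho) ->
  (forall x, 0 <= x <= m 0 -> 2 - rho <= fAC' (u x)) ->
  (forall x, m n <= x <= 1 -> 2 - rho <= fAC' (u x)) ->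
  (forall i, (i < n)%N ->
    itg (m i) (m i.+1) (fun x => v x * dU ((x - h i) / eps)) ^+ 2 / eps
    + eps * v (m i) ^+ 2 + eps * v (m i.+1) ^+ 2 <= e) ->
  5 / 8 * lam * itg 0 1 (fun x => v x ^+ 2) <=
    eps ^+ 2 * itg 0 1 (fun x => dv x ^+ 2)
    + itg 0 1 (fun x => fAC' (u x) * v x ^+ 2)
    + (delta + rho) * (eps ^+ 2 * itg 0 1 (fun x => dv x ^+ 2)
                       + itg 0 1 (fun x => v x ^+ 2))
    + n%:R * (C * e).
Proof.
move=> /andP[l0 l3] /andP[r0 r8] de0 C0 e0 gap hm m0 mn hv bu hin hl hr hE.
have bv := H1_on_bdd _ _ _ _ ler01 hv.
have iv2 : itgable 0 1 (fun x => v x ^+ 2) by exact/bdd_meas_itgable/bdd_measX.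
have idv2 : itgable 0 1 (fun x => dv x ^+ 2) by case: hv => [[]].
have iF : itgable 0 1 (fun x => fAC' (u x) * v x ^+ 2).
  apply: bdd_meas_itgable; apply: bdd_measM; last exact: bdd_measX.
  exact: bdd_meas_fAC'.
(* The inequality on one segment with error [er]. All other terms are integrals, so it adds up over
   adjacent segments without interface terms. *)
pose P a b er := 5 / 8 * lam * itg a b (fun x => v x ^+ 2) <=
    eps ^+ 2 * itg a b (fun x => dv x ^+ 2)
    + itg a b (fun x => fAC' (u x) * v x ^+ 2)
    + (delta + rho) * (eps ^+ 2 * itg a b (fun x => dv x ^+ 2)
                       + itg a b (fun x => v x ^+ 2)) + er.
have Padd a b c e1 e2 : 0 <= a -> a <= b -> b <= c -> c <= 1 ->
    P a b e1 -> P b c e2 -> P a c (e1 + e2).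
  move=> a0 ab bc c1 h1 h2; rewrite /P.
  have S f : itgable 0 1 f -> itg a c f = itg a b f + itg b c f.
    by move=> hf; apply: itg_split; [rewrite ab|exact: itgableS hf].
  by rewrite (S _ iv2) (S _ idv2) (S _ iF); rewrite /P in h1 h2; lra.
have nn a b : 0 <= itg a b (fun x => v x ^+ 2) /\ 0 <= itg a b (fun x => dv x ^+ 2).
  by split; apply: itg_ge0 => x _; exact: sqr_ge0.
have Pout a b : 0 <= a -> b <= 1 -> (forall x, a <= x <= b -> 2 - rho <= fAC' (u x)) ->
    P a b 0.
  move=> a0 b1 hu; rewrite /P.
  have [V0 D0] := nn a b.
  have h1 : (2 - rho) * itg a b (fun x => v x ^+ 2) <=
      itg a b (fun x => fAC' (u x) * v x ^+ 2).
    have iv2' := itgableS _ _ _ _ _ a0 b1 iv2.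
    rewrite -itgZ //; apply: le_itg; first exact: itgableZ.
      exact: itgableS iF.
    by move=> x xab; rewrite ler_wpM2r ?sqr_ge0 ?hu.
  have h2 : 5 / 8 * lam * itg a b (fun x => v x ^+ 2) <=
      (2 - rho) * itg a b (fun x => v x ^+ 2).
    by rewrite ler_wpM2r //; lra.
  have h3 : 0 <= eps ^+ 2 * itg a b (fun x => dv x ^+ 2) by rewrite mulr_ge0 ?sqr_ge0.
  have h4 : 0 <= (delta + rho) * (eps ^+ 2 * itg a b (fun x => dv x ^+ 2)
                       + itg a b (fun x => v x ^+ 2)).
    by rewrite mulr_ge0 ?addr_ge0.
  lra.
have Pin i : (i < n)%N -> 0 <= m i -> m i.+1 <= 1 -> P (m i) (m i.+1) (C * e).
  move=> ilt mi0 mi1; rewrite /P.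
  have [m1 m2] := hm _ ilt.
  have [V0 D0] := nn (m i) (m i.+1).
  have hv' := H1_onS _ _ _ _ _ _ mi0 mi1 hv.
  have g := gap _ _ _ _ _ _ e0 m1 m2 hv'.
  have hC := ler_wpM2l C0 (hE _ ilt).
  have h1 : itg (m i) (m i.+1) (fun x => fAC' (Uprof ((x - h i) / eps)) * v x ^+ 2) <=
      itg (m i) (m i.+1) (fun x => fAC' (u x) * v x ^+ 2)
      + rho * itg (m i) (m i.+1) (fun x => v x ^+ 2).
    have iv2' := itgableS _ _ _ _ _ mi0 mi1 iv2.
    have iF' := itgableS _ _ _ _ _ mi0 mi1 iF.
    rewrite -itgZ // -itgD //; last exact: itgableZ.
    apply: le_itg.
    - apply: bdd_meas_itgable; apply: bdd_measM.
        apply/bdd_meas_fAC'/bdd_meas_cont.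
        exact: continuous_rescale (@continuous_Uprof R).
      by apply: bdd_measX; exact: bdd_measS bv.
    - by apply: itgableD => //; exact: itgableZ.
    - move=> x xi; have := hin _ ilt _ xi; rewrite ler_norml => /andP[h1 h2].
      by rewrite -mulrDl ler_wpM2r ?sqr_ge0 //; lra.
  have h2 : 5 / 8 * lam * itg (m i) (m i.+1) (fun x => v x ^+ 2) <=
      lam * itg (m i) (m i.+1) (fun x => v x ^+ 2).
    by rewrite ler_wpM2r //; lra.
  have h3 : 0 <= rho * (eps ^+ 2 * itg (m i) (m i.+1) (fun x => dv x ^+ 2)).
    by rewrite mulr_ge0 // mulr_ge0 ?sqr_ge0.
  lra.
have mono i : (i < n)%N -> m i <= m i.+1 by move=> /hm[h1 h2]; lra.
have mle i j : (i <= j <= n)%N -> m i <= m j.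
  move=> /andP[]; elim: j => [|j ih]; first by rewrite leqn0 => /eqP ->.
  rewrite leq_eqVlt => /predU1P[->//|ij jn].
  by apply: le_trans (mono _ jn); apply: ih => //; exact: ltnW.
have Psum k : (k <= n)%N -> P 0 (m k) (k%:R * (C * e)).
  elim: k => [|k ih] kn.
    by rewrite mul0r; apply: Pout => //; apply: le_trans mn; apply: mle; rewrite leqnn leq0n.
  have mk0 : 0 <= m k by apply: (le_trans m0); apply: mle; rewrite leq0n ltnW.
  have mk1 : m k.+1 <= 1 by apply: le_trans mn; apply: mle; rewrite kn leqnn.
  rewrite -natr1 mulrDl mul1r; apply: (Padd _ (m k)) => //; first exact: mono.
    by apply: ih; exact: ltnW.
  exact: Pin.
have mn0 : 0 <= m n by apply: (le_trans m0); apply: mle; rewrite leq0n leqnn.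
have := Padd _ _ _ _ _ (lexx 0) mn0 mn (lexx 1) (Psum _ (leqnn n)) (Pout _ _ mn0 (lexx 1) hr).
by rewrite addr0.
Qed.

End Pieces.

(** * Cut points, overlap with the kinks and the cubic term *)

Section Kinks.
Context {R : realType}.
Local Notation dU := (derive1 (@Uprof R)).
Implicit Types (x eps kappa : R) (v dv : R -> R).

(** With [l = eps^(1 - kappa) / 8], consecutive entries of the extended sequence are more than [8 l]
    apart; its reflected entries keep the outer kinks [4 l] away from 0 and 1. Cut points are taken
    at distance between [l] and [2 l] to the left of each kink, and to the right of the last one. *)
Lemma cut_points N kappa eps (h : 'rV[R]_N.+1) v : 0 < eps -> Omega kappa eps h ->
  {within `[0, 1], continuous v} ->
  exists m : nat -> R, [/\ 0 <= m 0%N, m N.+1 <= 1,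
    forall i, (i < N.+1)%N -> m i <= hcoord h i - eps / eps `^ kappa / 8 /\
                             hcoord h i + eps / eps `^ kappa / 8 <= m i.+1 &
    forall j, (j <= N.+1)%N ->
      eps / eps `^ kappa / 8 * v (m j) ^+ 2 <= itg 0 1 (fun x => v x ^+ 2)].
Proof.
move=> e0 [h0 [hmono [hN hgap]]] cv.
set l := eps / eps `^ kappa / 8.
have l0 : 0 < l by rewrite !divr_gt0 ?powR_gt0.
have l8 k : (k <= N.+1)%N -> 8 * l < `|hext h k.+1 - hext h k|.
  by move=> /hgap; rewrite /l mulrCA divff ?pnatr_eq0 // mulr1.
have g0 : 4 * l < hcoord h 0.
  have := l8 0%N (leq0n _); rewrite /hext /= opprK gtr0_norm ?addr_gt0 //; lra.
have gN : hcoord h N < 1 - 4 * l.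
  have := l8 N.+1 (leqnn _); rewrite /hext /= ltnn leqnn.
  by rewrite gtr0_norm; lra.
have gj j : (j < N)%N -> hcoord h j + 8 * l < hcoord h j.+1.
  move=> jN; have := l8 j.+1 (leqW jN); rewrite /hext /= ltnS jN leqW //.
  have := hmono _ jN; move: (hcoord h j) (hcoord h j.+1) => a b ab.
  by rewrite gtr0_norm; lra.
have hpos j : (j <= N)%N -> 4 * l < hcoord h j.
  elim: j => // j ih jN; have := gj _ jN; have := ih (ltnW jN); lra.
have hle j : (j <= N)%N -> hcoord h j <= hcoord h N.
  move=> jN; rewrite -(subKn jN); elim: (N - j)%N (leq_subr j N) => [|k ih] kN.
    by rewrite subn0.
  apply: le_trans (ih (ltnW kN)).
  have sN : (N - k.+1 < N)%N by rewrite ltn_subrL /=; case: (N) kN.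
  by have := gj _ sN; rewrite subnSK //; lra.
(* The bound on [j] sits under the existential, so that the axiom of choice yields a sequence
   indexed by all of [nat]. *)
have : forall j, exists x, (j <= N.+1)%N -> [/\ 0 <= x <= 1,
    l * v x ^+ 2 <= itg 0 1 (fun x => v x ^+ 2),
    (j <= N)%N -> hcoord h j - 2 * l <= x <= hcoord h j - l &
    j = N.+1 -> hcoord h N + l <= x].
  move=> j; have [jN|jN] := leqP j N.
    have hj := hpos _ jN; have hj' := hle _ jN.
    have [||||x [xcd hx]] := @cut_point R 0 1 (hcoord h j - 2 * l) (hcoord h j - l) v;
      try lra; first exact: cv.
    exists x => _; split => //.
    - by move/andP: xcd => [? ?]; apply/andP; split; lra.
    - by move: hx; rewrite (_ : _ - _ - _ = l) //; ring.
    - by move=> jE; move: jN; rewrite jE ltnn.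
  have hj := hpos _ (leqnn N).
  have [||||x [xcd hx]] := @cut_point R 0 1 (hcoord h N + l) (hcoord h N + 2 * l) v;
      try lra; first exact: cv.
  exists x => jN'; split => //.
  - by move/andP: xcd => [? ?]; apply/andP; split; lra.
  - by move: hx; rewrite (_ : _ + _ - _ = l) //; ring.
  - by move/andP: xcd => [].
move=> /choice[m hm]; exists m.
have [/andP[m00 _] _ _ _] := hm 0%N (leq0n _).
have [/andP[_ m1] _ _ mN] := hm N.+1 (leqnn _).
split => //.
- move=> i iN; have [_ _ hi _] := hm i (ltnW iN).
  have /andP[_ hi2] := hi iN; split => //.
  have [_ _ hi3 hi4] := hm i.+1 iN.
  move: iN; rewrite ltnS leq_eqVlt => /predU1P[iN|iN].
    by rewrite iN; apply: mN.
  by have /andP[] := hi3 iN; have := gj _ iN; lra.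
- by move=> j /hm[].
Qed.

(** Orthogonality to [u^h_i], solved for the [U'] part, expresses the overlap over [[0, 1]] as [eps]
    times a pairing of [v] with the derivative of [beta]. Removing the two tails, where [U'] is at
    most [4 e^-d], leaves the overlap on [[a, b]]; each of the three terms is bounded by
    Cauchy-Schwarz. *)
Lemma overlap_small N (beta : R -> 'rV[R]_N.+1 -> R -> R) eps (h : 'rV[R]_N.+1)
    (i : 'I_N.+1) a b d M v dv : 0 < eps -> H1_on 0 1 v dv ->
  (forall x, derivable (fun h' => beta eps h' x) h (delta_mx 0 i)) ->
  bdd_meas 0 1 (fun x => 'D_(delta_mx 0 i) (fun h' => beta eps h' x) h) ->
  (forall x, 0 <= x <= 1 -> `|'D_(delta_mx 0 i) (fun h' => beta eps h' x) h| <= M) ->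
  L2ip v (uhi beta eps h i) = 0 -> 0 <= d -> 0 <= a -> a <= b -> b <= 1 ->
  (forall x, 0 <= x <= a -> d <= `|(x - h 0 i) / eps|) ->
  (forall x, b <= x <= 1 -> d <= `|(x - h 0 i) / eps|) ->
  itg a b (fun x => v x * dU ((x - h 0 i) / eps)) ^+ 2 <=
    3 * (2 * (4 * expR (- d)) ^+ 2 + (eps * M) ^+ 2) * itg 0 1 (fun x => v x ^+ 2).
Proof.
have fin (X Y Z q r W : R) : Y ^+ 2 <= q * W -> Z ^+ 2 <= q * W -> X ^+ 2 <= r * W ->
    (X - Y - Z) ^+ 2 <= 3 * (2 * q + r) * W.
  move=> hY hZ hX; have : (X - Y - Z) ^+ 2 <= 3 * (X ^+ 2 + Y ^+ 2 + Z ^+ 2).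
    have := sqr_ge0 (X + Y); have := sqr_ge0 (X + Z); have := sqr_ge0 (Y - Z); nra.
  lra.
move=> e0 hv db mDb bM orth d0 a0 ab b1 hl hr.
set Db := fun x => 'D_(delta_mx 0 i) (fun h' => beta eps h' x) h.
have bv := H1_on_bdd _ _ _ _ ler01 hv.
set V := itg 0 1 (fun x => v x ^+ 2).
pose w x := v x * dU ((x - h 0 i) / eps).
have bw : bdd_meas 0 1 w.
  apply: bdd_measM => //; apply: bdd_meas_cont.
  exact: continuous_rescale (@continuous_derive1_Uprof R).
have iv2 : itgable 0 1 (fun x => v x ^+ 2) by exact/bdd_meas_itgable/bdd_measX.
have tail p q k (g : R -> R) : 0 <= p -> p <= q -> q <= 1 -> bdd_meas 0 1 g ->
    (forall x, p <= x <= q -> `|g x| <= k) ->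
    itg p q (fun x => v x * g x) ^+ 2 <= k ^+ 2 * V.
  move=> p0 pq q1 bg gk.
  have bvg := bdd_measS _ _ _ _ _ p0 q1 (bdd_measM _ _ _ _ bv bg).
  apply: le_trans (itg_sqr_le _ _ _ pq (bdd_meas_sq _ _ _ bvg)) _.
  have i1 := bdd_meas_itgable _ _ _ (bdd_measX _ _ _ 2 bvg).
  have iv2' := itgableS _ _ _ _ _ p0 q1 iv2.
  have h1 : itg p q (fun x => (v x * g x) ^+ 2) <= k ^+ 2 * itg p q (fun x => v x ^+ 2).
    rewrite -itgZ //; apply: le_itg => //; first exact: itgableZ.
    move=> x xpq; rewrite exprMn mulrC ler_wpM2r ?sqr_ge0 //.
    rewrite -real_normK ?num_real // ler_sqr ?nnegrE ?gk //.
    exact: le_trans (gk _ xpq).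
  have h2 : itg p q (fun x => v x ^+ 2) <= V.
    by apply: le_itg_sub => // x _; exact: sqr_ge0.
  have h3 : 0 <= itg p q (fun x => (v x * g x) ^+ 2).
    by apply: itg_ge0 => x _; exact: sqr_ge0.
  have h4 := ler_wpM2l (sqr_ge0 k) h2.
  have : (q - p) * itg p q (fun x => (v x * g x) ^+ 2) <=
      1 * itg p q (fun x => (v x * g x) ^+ 2) by rewrite ler_wpM2r //; lra.
  lra.
have bdUi : bdd_meas 0 1 (fun x => dU ((x - h 0 i) / eps)).
  by apply: bdd_meas_cont; exact: continuous_rescale (@continuous_derive1_Uprof R).
have far x : d <= `|(x - h 0 i) / eps| -> `|dU ((x - h 0 i) / eps)| <= 4 * expR (- d).
  by move=> dx; rewrite ger0_norm ?derive1_Uprof_ge0 //; exact: derive1_Uprof_far.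
have t1 : itg 0 a w ^+ 2 <= (4 * expR (- d)) ^+ 2 * V.
  by apply: tail => //; [exact: le_trans b1|move=> x /hl /far].
have t2 : itg b 1 w ^+ 2 <= (4 * expR (- d)) ^+ 2 * V.
  by apply: tail => //; [exact: le_trans ab|move=> x /hr /far].
have t3 : itg 0 1 (fun x => v x * Db x) ^+ 2 <= M ^+ 2 * V by apply: tail.
have t4 : itg 0 1 w ^+ 2 <= (eps * M) ^+ 2 * V.
  have E : itg 0 1 (fun x => v x * Db x) = (-1) ^+ i / eps * itg 0 1 w.
    have : itg 0 1 (fun x => v x * uhi beta eps h i x) = 0 by exact: orth.
    rewrite (@eq_itg R 0 1 _ (fun x => - ((-1) ^+ i / eps) * w x + v x * Db x)); last first.
      by move=> x _; rewrite uhi_split // /w /Db; ring.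
    rewrite itgD; first last.
    - by apply: bdd_meas_itgable; exact: bdd_measM.
    - exact/itgableZ/bdd_meas_itgable.
    rewrite (itgZ 0 1 (- ((-1) ^+ i / eps)) w) ?(bdd_meas_itgable _ _ _ bw) //.
    by rewrite mulNr addrC => /eqP; rewrite subr_eq0 => /eqP.
  have -> : itg 0 1 w ^+ 2 = eps ^+ 2 * itg 0 1 (fun x => v x * Db x) ^+ 2.
    rewrite E !exprMn sqrr_sign mul1r exprVn mulrA divff ?mul1r //.
    by rewrite expf_neq0 // gt_eqF.
  by rewrite exprMn -[leRHS]mulrA ler_wpM2l ?sqr_ge0.
have iw := bdd_meas_itgable _ _ _ bw.
have S1 : itg 0 1 w = itg 0 a w + itg a 1 w.
  by apply: itg_split => //; rewrite a0 (le_trans ab).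
have S2 : itg a 1 w = itg a b w + itg b 1 w.
  by apply: itg_split; [rewrite ab|exact: itgableS iw].
rewrite -/w.
have -> : itg a b w = itg 0 1 w - itg 0 a w - itg b 1 w by rewrite S1 S2; ring.
exact: fin.
Qed.

(** The integrand is [-3 u v^3 - v^4], whose quartic part has the good sign. Young gives
    [-3 u v <= tau + (3 B)^2 v^2 / (4 tau)], and the sup bound at scale [eps] turns the last term,
    integrated against [v^2], into [(3 B)^2 (V / eps) / (2 tau)] times [eps^2 |v'|^2 + V]; this is
    where [V / eps] must be small. *)
Lemma nonlinear_small B tau g eps (u v dv : R -> R) : 0 < eps <= 2^-1 -> 0 < tau -> 0 <= g ->
  (3 * B) ^+ 2 * g <= 2 * tau ^+ 2 ->
  H1_on 0 1 v dv -> bdd_meas 0 1 u -> (forall x, 0 <= x <= 1 -> `|u x| <= B) ->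
  itg 0 1 (fun x => v x ^+ 2) <= eps * g ->
  itg 0 1 (fun x => (fAC (u x) - fAC (u x + v x) + fAC' (u x) * v x) * v x) <=
    tau * itg 0 1 (fun x => v x ^+ 2)
    + tau * (eps ^+ 2 * itg 0 1 (fun x => dv x ^+ 2) + itg 0 1 (fun x => v x ^+ 2)).
Proof.
move=> /andP[e0 e2] t0 g0 Bg hv bu uB hV.
have bv := H1_on_bdd _ _ _ _ ler01 hv.
have iv2 : itgable 0 1 (fun x => v x ^+ 2) by exact/bdd_meas_itgable/bdd_measX.
have supv x := H1_on01_sup _ _ eps x hv (introT andP (conj e0 e2)).
set V := itg 0 1 (fun x => v x ^+ 2) in hV supv *.
set D := itg 0 1 (fun x => dv x ^+ 2) in supv *.
have V0 : 0 <= V by apply: itg_ge0 => x _; exact: sqr_ge0.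
have D0 : 0 <= D by apply: itg_ge0 => x _; exact: sqr_ge0.
pose S := 2 * (V / eps + eps * D).
have S0 : 0 <= S by rewrite mulr_ge0 // addr_ge0 ?divr_ge0 ?mulr_ge0 // ltW.
pose k := tau + (3 * B) ^+ 2 / (4 * tau) * S.
have h1 : itg 0 1 (fun x => (fAC (u x) - fAC (u x + v x) + fAC' (u x) * v x) * v x) <= k * V.
  rewrite -itgZ //; apply: le_itg; last 1 first.
  - move=> x x01; have ub := uB _ x01; have vs := supv _ x01.
    have -> : (fAC (u x) - fAC (u x + v x) + fAC' (u x) * v x) * v x =
        - (3 * u x * v x) * v x ^+ 2 - (v x ^+ 2) ^+ 2 by rewrite /fAC /fAC'; ring.
    have v4 := sqr_ge0 (v x ^+ 2).
    have : - (3 * u x * v x) <= k.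
      have y1 : - (3 * u x * v x) <= tau + (3 * u x) ^+ 2 / (4 * tau) * v x ^+ 2.
        rewrite -subr_ge0 (_ : _ - _ = (2 * tau + 3 * u x * v x) ^+ 2 / (4 * tau)).
          by rewrite divr_ge0 ?sqr_ge0 // mulr_ge0 // ltW.
        by field; rewrite gt_eqF.
      apply: (le_trans y1); rewrite /k lerD2l; apply: ler_pM => //.
      - by rewrite divr_ge0 ?sqr_ge0 // mulr_ge0 // ltW.
      - exact: sqr_ge0.
      - have t4 : 0 <= (4 * tau)^-1 by rewrite invr_ge0 mulr_ge0 // ltW.
        rewrite ler_wpM2r // !exprMn ler_wpM2l ?sqr_ge0 // -real_normK ?num_real //.
        by rewrite ler_sqr ?nnegrE // (le_trans _ ub).
    move=> hk; have := ler_wpM2r (sqr_ge0 (v x)) hk; lra.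
  - have bfA f : bdd_meas 0 1 f -> bdd_meas 0 1 (fun x => fAC (f x) : R).
      by move=> bf; apply: bdd_measB => //; exact: bdd_measX.
    apply: bdd_meas_itgable; apply: bdd_measM => //; apply: bdd_measD.
      by apply: bdd_measB; apply: bfA => //; exact: bdd_measD.
    by apply: bdd_measM => //; exact: bdd_meas_fAC'.
  - exact: itgableZ.
apply: (le_trans h1); rewrite /k mulrDl lerD2l.
have Ve : V / eps <= g by rewrite ler_pdivrMr // mulrC.
have -> : (3 * B) ^+ 2 / (4 * tau) * S * V =
    ((3 * B) ^+ 2 * (V / eps)) / (2 * tau) * (eps ^+ 2 * D + V).
  by rewrite /S; field; rewrite !gt_eqF.
have T0 : 0 <= eps ^+ 2 * D + V by rewrite addr_ge0 // mulr_ge0 ?sqr_ge0.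
rewrite ler_wpM2r // ler_pdivrMr ?mulr_gt0 //.
apply: (le_trans (ler_wpM2l (sqr_ge0 (3 * B)) Ve)); apply: (le_trans Bg).
by rewrite expr2; lra.
Qed.

End Kinks.

(** * Choice of constants and conclusion *)

Lemma absorb_errors (R : realFieldType) (lam s V D Q : R) :
  0 < lam -> lam <= 3 -> 0 <= V -> 0 <= D -> lam = 200 * s -> D - V <= Q ->
  5 / 8 * lam * V <= Q + (s + s) * (D + V) + s * V ->
  - Q + (s * V + s * (D + V)) <= - (lam / 2) * V.
Proof.
move=> l0 l3 V0 D0 ls hQ hl.
(* Convex combination of the two hypotheses with weight [lam / 32 = 6.25 s] on the crude one: it
   yields more [D] than the errors consume, and [lam <= 3] keeps its cost in [V] below the margin
   between 5/8 and 1/2. *)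
have t0 : 0 <= lam / 32 by rewrite divr_ge0 // ltW.
have t1 : 0 <= 1 - lam / 32 by lra.
have c1 := ler_wpM2l t1 hl; have c2 := ler_wpM2l t0 hQ.
have sV : 0 <= s * V by rewrite mulr_ge0 //; lra.
have sD : 0 <= s * D by rewrite mulr_ge0 //; lra.
have lsV : 0 <= s * (s * V) by rewrite mulr_ge0 //; lra.
have lsD : 0 <= s * (s * D) by rewrite mulr_ge0 //; lra.
have lsV3 : 200 * s * (s * V) <= 3 * (s * V) by rewrite ler_wpM2r // -ls.
rewrite ls in c1 c2 *; lra.
Qed.

Lemma bdd_meas_sum (R : realType) (a b : R) n (F : 'I_n -> R -> R) :
  (forall i, bdd_meas a b (F i)) -> bdd_meas a b (fun x => \sum_(i < n) F i x).
Proof.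
elim: n F => [|n ih] F hF.
  by under eq_fun do rewrite big_ord0; exact: bdd_meas_cst.
under eq_fun do rewrite big_ord_recr.
by apply: bdd_measD => //; exact: ih.
Qed.

Lemma Uprof_sum_bound (R : realType) N (z : 'I_N.+1 -> R) :
  `|\sum_(k < N.+1) (-1) ^+ k * Uprof (z k)| <= N.+1%:R.
Proof.
have := @sign_sum_dist R N.+1 (fun k => Uprof (z k)) (fun=> 0) 1.
have -> : \sum_(k < N.+1) (-1) ^+ k * 0 = 0 :> R.
  by apply: big1 => *; rewrite mulr0.
rewrite subr0 mulr1; apply=> k; rewrite subr0 ler_norml; have /andP[? ?] := Uprof_bound (z k).
by rewrite !ltW.
Qed.

Lemma cN_bound (R : realType) N : `|cN R N| <= 1.
Proof.
by rewrite /cN -signr_odd; case: (odd N); rewrite ?expr0 ?expr1 ler_norml; apply/andP; split; lra.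
Qed.

Theorem theorem6p2 (R : realType) (N : nat) (lam0 : R) :
  0 < lam0 -> spectral_gap lam0 ->
  exists kbar : R, 0 < kbar /\
  forall kappa0 : R, 0 < kappa0 < kbar ->
  forall m : R, 0 < m ->
  forall beta : R -> 'rV[R]_N.+1 -> R -> R, beta_adm kappa0 beta ->
  exists eps0 : R, 0 < eps0 /\
  forall eps : R, 0 < eps < eps0 ->
  forall h : 'rV[R]_N.+1, Omega kappa0 eps h ->
  forall v dv : R -> R, H1_01 v dv ->
    (forall i : 'I_N.+1, L2ip v (uhi beta eps h i) = 0) ->
    L2norm v < eps `^ (1 / 2 + m) ->
    form_LN beta eps h v dv <= - (lam0 / 2) * L2norm v ^+ 2.
Proof.
move=> l0 gap; exists 1; split; first exact: ltr01.
move=> kappa /andP[ka0 _] m m0 beta [C [c [k [C0 [c0 [k0 adm]]]]]].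
have l3 := gap_le3 _ l0 gap.
(* [s] is the common size of all errors: tolerance of the gap, deviation of [f'(u^h)] from its
   model, cutting and overlap, and cubic term. *)
have [s [s0 ls]] : exists s, 0 < s /\ lam0 = 200 * s.
  by exists (lam0 / 200); split; lra.
have s8 : 0 <= s <= 8^-1 by apply/andP; split; lra.
have s9 (x : R) : 9 * x <= s -> x <= 1 by move: s8 => /andP[_] *; lra.
have [G [G0 gapG]] := approx_gap_rescaled _ l0 gap _ s0.
have c8 : 0 < 8^-1 :> R by rewrite invr_gt0.
have [K1 [K10 hK1]] := expR_powR_le _ _ c8 ka0.
have [K2 [K20 hK2]] := expR_powR_le _ _ c0 k0.
have n0 : 0 < N.+1%:R :> R by rewrite ltr0n.
pose Ke := N.+1%:R * (2 * K1) + C * K2.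
have Ke0 : 0 < Ke by rewrite addr_gt0 ?mulr_gt0.
(* Each of the [N + 1] kink pieces may contribute [G * E * V], and together they give [s * V]. *)
pose E := s / (N.+1%:R * G).
have E0 : 0 < E by rewrite divr_gt0 ?mulr_gt0.
(* The factor of [overlap_small] once each exponential is bounded by a multiple of [eps], with
   [eps^2] taken out. *)
pose KE := 3 * (32 * K1 ^+ 2 + (C * K2) ^+ 2).
have KE0 : 0 < KE by rewrite mulr_gt0 // addr_gt0 ?mulr_gt0 ?exprn_gt0 ?mulr_gt0.
(* Sup bound for [u^h]: one for each kink, one for [cN], one for [beta - cN]. *)
pose B : R := N.+1%:R + 2.
have B0 : 0 < B by rewrite addr_gt0.
pose gB := 2 * s ^+ 2 / (3 * B) ^+ 2.
have gB0 : 0 < gB by rewrite divr_gt0 ?mulr_gt0 ?exprn_gt0 ?mulr_gt0.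
have m20 : 0 < 2 * m by rewrite mulr_gt0.
have p1 : 0 < 2^-1 :> R by rewrite invr_gt0.
have p2 : 0 < s / (9 * Ke) by rewrite divr_gt0 ?mulr_gt0.
have p3 : 0 < E / 32 by rewrite divr_gt0.
have p4 : 0 < E / (2 * KE) by rewrite divr_gt0 // mulr_gt0.
have [e0 [e00 he0]] := small_epsI _ _ (small_eps_lt _ p1)
  (small_epsI _ _ (small_eps_lt _ p2) (small_epsI _ _ (small_eps_powR _ _ ka0 c8)
  (small_epsI _ _ (small_eps_powR _ _ ka0 p3) (small_epsI _ _ (small_eps_lt _ p4)
  (small_eps_powR _ _ m20 gB0))))).
exists e0; split => // eps epsI.
have [ehalf [eKe [ek8 [ekE [eKE em]]]]] := he0 _ epsI.
have /andP[ep0 _] := epsI.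
have ep1 : 0 < eps < 1 by apply/andP; split => //; lra.
have /andP[_ eps1] := ep1.
move=> h hO v dv /H1_on01 hv orth vsmall.
have [bder bhder bbd _ _] := adm _ _ ep1 hO.
set M := C * expR (- c / eps `^ k) in bbd.
have xk0 : 0 < eps `^ kappa by exact: powR_gt0.
(* The distance [l] from kinks to cut points in the stretched variable. Since [eps^kappa <= 1/8], it
   is at least 1, which leaves the room of [eps] around each kink that the rescaled gap requires. *)
pose d := 8^-1 / eps `^ kappa.
have d0 : 0 <= d by rewrite divr_ge0 ?invr_ge0 // ltW.
have dle : expR (- d) <= K1 * eps by exact: hK1.
have M0 : 0 <= M by rewrite mulr_ge0 ?expR_ge0 // ltW.
have Mle : M <= C * K2 * eps.
  by rewrite /M -mulrA mulNr; apply: ler_wpM2l (hK2 _ ep1); exact: ltW.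
have dE : d * eps = eps / eps `^ kappa / 8 by rewrite /d mulrC mulrCA mulrC mulrAC.
have epsd : eps <= d * eps.
  rewrite -[leLHS]mul1r ler_wpM2r //; first exact: ltW.
  by rewrite /d ler_pdivlMr // mul1r.
pose eta := N.+1%:R * (2 * expR (- d)) + M.
have eta0 : 0 <= eta by rewrite addr_ge0 // mulr_ge0 // mulr_ge0 // expR_ge0.
have etale : 9 * eta <= s.
  have h1 : eta <= Ke * eps.
    rewrite /Ke mulrDl lerD // -!mulrA ler_wpM2l // ler_wpM2l //.
  have h2 : Ke * eps <= s / 9.
    move: eKe => /ltW; rewrite invfM mulrA ler_pdivlMr // mulrC => h2.
    exact: h2.
  lra.
have eta1 : 0 <= eta <= 1 by rewrite eta0 s9.
have cv := H1_on_within _ _ _ _ ler01 hv.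
have [mm [mm0 mmN mmh mmV]] := cut_points _ _ _ _ _ ep0 hO cv.
rewrite -dE in mmh mmV.
set V := itg 0 1 (fun x => v x ^+ 2) in mmV.
have V0 : 0 <= V by apply: itg_ge0 => x _; exact: sqr_ge0.
set D := eps ^+ 2 * itg 0 1 (fun x => dv x ^+ 2).
have D0 : 0 <= D by rewrite mulr_ge0 ?sqr_ge0 // itg_ge0 // => x _; exact: sqr_ge0.
have de0 : 0 < d * eps by exact: lt_le_trans epsd.
have mono i : (i < N.+1)%N -> mm i <= mm i.+1.
  move=> /mmh[h1 h2]; apply: (le_trans h1); apply: le_trans h2.
  by rewrite lerD2l -subr_ge0 opprK addr_ge0 // ltW.
have mle i j : (i <= j)%N -> (j <= N.+1)%N -> mm i <= mm j.
  elim: j => [|j ih]; first by rewrite leqn0 => /eqP ->.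
  rewrite leq_eqVlt => /predU1P[->//|ij jn].
  by apply: le_trans (mono _ jn); apply: ih => //; exact: ltnW.
have hcE (k' : 'I_N.+1) : hcoord h k' = h 0 k' by rewrite /hcoord inord_val.
have left_of (k' : 'I_N.+1) x : x <= mm k' -> (x - h 0 k') / eps <= - d.
  have [h1 _] := mmh _ (ltn_ord k'); rewrite hcE in h1.
  by move=> xm; rewrite ler_pdivrMr // mulNr; lra.
have right_of (k' : 'I_N.+1) x : mm k'.+1 <= x -> d <= (x - h 0 k') / eps.
  have [_ h1] := mmh _ (ltn_ord k'); rewrite hcE in h1.
  by move=> xm; rewrite ler_pdivlMr //; lra.
have bM x : 0 <= x <= 1 -> `|beta eps h x - cN R N| <= M by move=> /bbd[].
have cbeta : continuous (beta eps h).
  by move=> x; apply: differentiable_continuous; apply/derivable1_diffP; exact: bder.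
have bu : bdd_meas 0 1 (uh beta eps h).
  apply: bdd_measD; last exact: bdd_meas_cont.
  apply: bdd_meas_sum => i; apply: bdd_measM; first exact: bdd_meas_cst.
  by apply: bdd_meas_cont; exact: continuous_rescale (@continuous_Uprof R).
have mm_in j : (j <= N.+1)%N -> 0 <= mm j <= 1.
  move=> jN; rewrite (le_trans mm0) ?mle //=; apply: le_trans mmN.
  exact: mle.
have hin i : (i < N.+1)%N -> forall x, mm i <= x <= mm i.+1 ->
    `|fAC' (uh beta eps h x) - fAC' (Uprof ((x - hcoord h i) / eps))| <= s.
  move=> iN x /andP[x1 x2]; apply: le_trans etale.
  rewrite -[i]/(nat_of_ord (Ordinal iN)) hcE.
  have x01 : 0 <= x <= 1.
    have /andP[y0 _] := mm_in i (ltnW iN); have /andP[_ y1] := mm_in i.+1 iN.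
    by rewrite (le_trans y0 x1) (le_trans x2 y1).
  apply: (@fAC'_near_kink _ _ ((-1) ^+ (Ordinal iN))) => //.
  - exact: sqrr_sign.
  - by have /andP[? ?] := Uprof_bound ((x - h 0 (Ordinal iN)) / eps); rewrite !ltW.
  - apply: uh_near_kink => //; first exact: bM.
    + move=> k' /= ki; apply: right_of; apply: le_trans x1; apply: mle => //.
      exact: ltnW.
    + move=> k' /= ik; apply: left_of; apply: (le_trans x2); apply: mle => //.
      exact/ltnW/ltn_ord.
have hl x : 0 <= x <= mm 0%N -> 2 - s <= fAC' (uh beta eps h x).
  move=> /andP[x0 xm]; apply: (@le_trans _ _ (2 - 9 * eta)); first by rewrite lerB.
  apply: (@fAC'_far _ _ ((-1) ^+ 0)) => //; first by rewrite expr0 expr1n.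
  apply: uh_far => //.
    by apply: bM; have /andP[_ y1] := mm_in 0%N (leq0n _); rewrite x0 (le_trans xm y1).
  move=> k'; rewrite ltn0; apply: left_of; apply: (le_trans xm); apply: mle => //.
  exact/ltnW/ltn_ord.
have hr x : mm N.+1 <= x <= 1 -> 2 - s <= fAC' (uh beta eps h x).
  move=> /andP[xm x1]; apply: (@le_trans _ _ (2 - 9 * eta)); first by rewrite lerB.
  apply: (@fAC'_far _ _ ((-1) ^+ N.+1)) => //; first exact: sqrr_sign.
  apply: uh_far => //.
    by apply: bM; have /andP[y0 _] := mm_in N.+1 (leqnn _); rewrite x1 (le_trans y0 xm).
  move=> k'; rewrite ltn_ord; apply: right_of; apply: le_trans xm.
  by apply: mle => //; exact: ltn_ord.
(* The budget [E] is shared as [E/2] for the overlap and [E/4] for each end value. *)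
have hE i : (i < N.+1)%N ->
    itg (mm i) (mm i.+1) (fun x => v x * derive1 (@Uprof R) ((x - hcoord h i) / eps)) ^+ 2 / eps
    + eps * v (mm i) ^+ 2 + eps * v (mm i.+1) ^+ 2 <= E * V.
  move=> iN; pose i' := Ordinal iN.
  have -> : hcoord h i = h 0 i' by rewrite -hcE.
  have /andP[mi0 mi1] := mm_in i (ltnW iN).
  have /andP[mj0 mj1] := mm_in i.+1 iN.
  have bDb x : 0 <= x <= 1 ->
      `|'D_(delta_mx 0 i') (fun h' => beta eps h' x) h| <= M by move=> /bbd[].
  have bh' x : derivable (fun h' => beta eps h' x) h (delta_mx 0 i') by exact: bhder.
  have mDb : bdd_meas 0 1 (fun x => 'D_(delta_mx 0 i') (fun h' => beta eps h' x) h).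
    apply: (bdd_meas_Dbeta _ _ kappa _ _ _ M); [exact: hO| |exact: bh'|exact: bDb].
    by move=> h' hO'; have [hd' _ _ _ _] := adm _ _ ep1 hO'.
  have o1 := overlap_small _ _ _ _ _ (mm i) (mm i.+1) _ _ _ _ ep0 hv bh' mDb bDb (orth i')
    d0 mi0 (mono _ iN) mj1.
  have {}o1 := o1 ltac:(move=> x /andP[_ xm]; rewrite ler_normr; apply/orP; right;
    by rewrite lerNr; apply: left_of) ltac:(move=> x /andP[xm _]; rewrite ler_normr;
    apply/orP; left; by apply: right_of).
  (* The window of length [eps^(1 - kappa) / 8] leaves a factor [8 eps^kappa], at most [E/4] because
     [eps^kappa <= E/32]. *)
  have cutv j : (j <= N.+1)%N -> eps * v (mm j) ^+ 2 <= E / 4 * V.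
    move=> jN; have := mmV _ jN; rewrite /d mulrAC -mulrA => h1.
    have h2 : eps * v (mm j) ^+ 2 <= 8 * eps `^ kappa * V.
      have -> : eps * v (mm j) ^+ 2 =
        8 * eps `^ kappa * (8^-1 * (eps * ((eps `^ kappa)^-1 * v (mm j) ^+ 2))).
        by field; rewrite gt_eqF.
      apply: ler_wpM2l; first by rewrite mulr_ge0 // ltW.
      apply: le_trans h1; rewrite le_eqVlt; apply/orP; left; apply/eqP; ring.
    apply: (le_trans h2); rewrite ler_wpM2r //; lra.
  have c1 := cutv _ (ltnW iN); have c2 := cutv _ iN.
  (* The squared overlap is at most [KE * eps^2 * V]: one power of [eps] pays for the weight
     [1 / eps], the other makes the result small. *)
  have o2 : itg (mm i) (mm i.+1) (fun x => v x * derive1 (@Uprof R) ((x - h 0 i') / eps)) ^+ 2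
      / eps <= E / 2 * V.
    rewrite ler_pdivrMr //; apply: (le_trans o1).
    rewrite [leRHS]mulrAC ler_wpM2r //.
    have q1 : (4 * expR (- d)) ^+ 2 <= 16 * (K1 ^+ 2 * eps ^+ 2).
      have -> : 16 * (K1 ^+ 2 * eps ^+ 2) = (4 * (K1 * eps)) ^+ 2 by ring.
      have x0 : 0 <= 4 * expR (- d) by rewrite mulr_ge0 // expR_ge0.
      have x1 : 4 * expR (- d) <= 4 * (K1 * eps) by rewrite ler_wpM2l.
      by rewrite ler_sqr ?nnegrE // (le_trans x0).
    have q2 : (eps * M) ^+ 2 <= (C * K2) ^+ 2 * eps ^+ 2.
      have x0 : 0 <= eps * M by rewrite mulr_ge0 // ltW.
      have x1 : eps * M <= C * K2 * eps.
        by apply: le_trans Mle; rewrite ler_piMl // ltW.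
      by rewrite -exprMn ler_sqr ?nnegrE // (le_trans x0).
    have q3 : KE * eps <= E / 2.
      move: eKE => /ltW; rewrite invfM mulrA ler_pdivlMr // mulrC; exact.
    have q4 := ler_wpM2r (ltW ep0) q3.
    move: q1 q2 q4; rewrite /KE; lra.
  lra.
have Q := pieces_coercive lam0 s s G eps N.+1 (hcoord h) mm (uh beta eps h) v dv (E * V).
have {}Q := Q ltac:(by rewrite l0 l3) s8 (ltW s0) (ltW G0) ep0 gapG.
have sep i : (i < N.+1)%N -> mm i <= hcoord h i - eps /\ hcoord h i + eps <= mm i.+1.
  move=> /mmh[h1 h2]; split; first by apply: (le_trans h1); rewrite lerB.
  by apply: le_trans h2; rewrite lerD2l.
have {}Q := Q sep mm0 mmN hv bu hin hl hr hE.
have GE : N.+1%:R * (G * (E * V)) = s * V by rewrite /E; field; rewrite !gt_eqF.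
rewrite GE -/D -/V in Q.
set F := itg 0 1 (fun x => fAC' (uh beta eps h x) * v x ^+ 2) in Q.
have bv := H1_on_bdd _ _ _ _ ler01 hv.
have FV : - V <= F.
  rewrite -mulN1r -itgZ; last exact/bdd_meas_itgable/bdd_measX.
  apply: le_itg.
  - by apply/itgableZ/bdd_meas_itgable/bdd_measX.
  - by apply: bdd_meas_itgable; apply: bdd_measM; [exact: bdd_meas_fAC'|exact: bdd_measX].
  - move=> x _; apply: ler_wpM2r; first exact: sqr_ge0.
    by rewrite /fAC'; have := sqr_ge0 (uh beta eps h x); lra.
have VE : L2norm v ^+ 2 = V.
  have L0 : L2ip v v = V by apply: eq_itg => x _; rewrite expr2.
  by rewrite /L2norm sqr_sqrtr L0.
(* [|v|^2] is below [eps * eps^(2 m)], and [eps^(2 m) <= gB], the value for which the smallness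
   condition on the cubic term is an equality. *)
have Vle : V <= eps * gB.
  rewrite -VE; apply: (@le_trans _ _ ((eps `^ (1 / 2 + m)) ^+ 2)).
    by rewrite ler_sqr ?nnegrE ?powR_ge0 ?sqrtr_ge0 // ltW.
  rewrite -powR_mulrn ?powR_ge0 // -powRrM.
  have -> : (1 / 2 + m) * 2 = 1 + 2 * m by field.
  rewrite powRD; last by rewrite (gt_eqF ep0) implybT.
  have ep0' := ltW ep0.
  by rewrite powRr1 // ler_wpM2l.
have M1 : M <= 1.
  case/andP: eta1 => _; apply: le_trans.
  by rewrite lerDr mulr_ge0 // mulr_ge0 // expR_ge0.
have uB x : 0 <= x <= 1 -> `|uh beta eps h x| <= B.
  move=> /bM bx; have := @Uprof_sum_bound R N (fun k' : 'I_N.+1 => (x - h 0 k') / eps).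
  rewrite /uh /B => hU; apply: (le_trans (ler_normD _ _)); apply: lerD => //.
  rewrite -[beta eps h x](subrK (cN R N)); apply: (le_trans (ler_normD _ _)).
  apply: lerD; first exact: le_trans bx M1.
  exact: cN_bound.
have NL := nonlinear_small B s gB eps (uh beta eps h) v dv.
have {}NL := NL ltac:(by rewrite ep0 ltW) s0 (ltW gB0).
have BgB : (3 * B) ^+ 2 * gB <= 2 * s ^+ 2.
  by rewrite /gB mulrC divfK // gt_eqF // exprn_gt0 // mulr_gt0.
have {}NL := NL BgB hv bu uB Vle.
rewrite VE.
have -> : form_LN beta eps h v dv = - (D + F) +
    itg 0 1 (fun x => (fAC (uh beta eps h x) - fAC (uh beta eps h x + v x)
                       + fAC' (uh beta eps h x) * v x) * v x).
  by rewrite /D opprD -mulNr.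
apply: le_trans (absorb_errors _ lam0 s V D (D + F) l0 l3 V0 D0 ls _ Q); last by rewrite lerD2l.
by rewrite lerD2l.
Qed.
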